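(* For all integers $p,q>1$, \begin{align*} (1-(-1)^{p+q})\hat S_{1p,q}&=(-1)^{p-1}(1+(-1)^q)\widetilde{t}(p)\hat S_{1,q}+(-1)^p\sum_{l=0}^p ((-1)^l-1)\binom{p+q-l-1}{q-1}\widetilde{t}(l+1)\widetilde{t}(p+q-l)\\ &\quad+(-1)^{p-1}\sum_{l=0}^{p-1}((-1)^l-1)\binom{p+q-l-2}{q-1}\widetilde{t}(l+1)\left(\sum_{n=1}^\infty \frac{H_{n-1}}{(n-1/2)^{p+q-l-1}}+2\log(2)\widetilde{t}(p+q-l-1) \right)\\ &\quad+(-1)^{p-1}\sum_{k=1}^{p-1}\sum_{l=0}^{p-k-1}((-1)^l-1)\binom{p+q-k-l-2}{q-1}\widetilde{t}(l+1)\\ &\qquad\times\left(\sum_{n=1}^\infty \frac{H_{n-1}^{(k+1)}}{(n-1/2)^{p+q-k-l-1}} -(-1)^k \zeta(k+1)\widetilde{t}(p+q-k-l-1)\right)\\ &\quad+(-1)^p\sum_{\substack{k_1+k_2=q+1\\ k_1,k_2\geq 1}} \binom{k_2+p-2}{p-1}\widetilde{t}(k_1+1)\widetilde{t}(k_2+p-1)\\ &\quad-2(-1)^p\sum_{\substack{2k_1+k_2+k_3=q+1\\ k_1,k_2,k_3\geq 1}} \binom{k_3+p-2}{p-1}\zeta(2k_1)\widetilde{t}(k_2+1)\widetilde{t}(k_3+p-1). \end{align*}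
   Context: Let $h_n^{(p)}=\sum_{k=1}^n (k-1/2)^{-p}$, $h_n=h_n^{(1)}$, and $H_n^{(p)}=\sum_{k=1}^n k^{-p}$, $H_n=H_n^{(1)}$ (empty sums are $0$). Define $\hat S_{1,q}=\sum_{n\ge1}\frac{h_n}{n^q}$ and $\hat S_{1p,q}=\sum_{n\ge1}\frac{h_nh_n^{(p)}}{n^q}$. For $s>1$, $\widetilde t(s)=\sum_{n\ge1}(n-1/2)^{-s}=(2^s-1)\zeta(s)$; $\zeta$ is the Riemann zeta function; terms with $\widetilde t(1)$ occur only with coefficient $0$. *)

(* Defs.v *)
From Stdlib Require Export Reals.
From Coquelicot Require Export Coquelicot.
Open Scope R_scope.

(* [sum_n_m a i j] is the sum over i <= k <= j, and is 0 when j < i. *)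
Definition fsum (i j : nat) (a : nat -> R) : R := sum_n_m a i j.

(* Coquelicot's [Series] starts at index 0; this one starts at index 1. *)
Definition Series1 (a : nat -> R) : R := Series (fun n => a (S n)).

(* [Coquelicot.Complex] shadows the real-valued binomial [C] of the Stdlib.
   [Binomial.C n k] is the binomial coefficient only for k <= n. *)
Definition binom (n k : nat) : R := Binomial.C n k.

Definition hnum (p n : nat) : R := fsum 1 n (fun k => / (INR k - 1 / 2) ^ p).

Definition Hnum (p n : nat) : R := fsum 1 n (fun k => / INR k ^ p).

Definition zeta (s : nat) : R := Series1 (fun n => / INR n ^ s).

(* Meaningful for s > 1 only, where the series converges. *)
Definition ttilde (s : nat) : R := Series1 (fun n => / (INR n - 1 / 2) ^ s).

Definition Shat1 (q : nat) : R := Series1 (fun n => hnum 1 n / INR n ^ q).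

Definition Shat1p (p q : nat) : R :=
  Series1 (fun n => hnum 1 n * hnum p n / INR n ^ q).

(* Sums over positive tuples with a linear constraint: every part of a solution
   is at most N, so the indices range over 1..N and the constraint is tested. *)
Definition sum_pairs (N : nat) (f : nat -> nat -> R) : R :=
  fsum 1 N (fun k1 => fsum 1 N (fun k2 =>
    if Nat.eqb (k1 + k2) N then f k1 k2 else 0)).

Definition sum_triples (N : nat) (f : nat -> nat -> nat -> R) : R :=
  fsum 1 N (fun k1 => fsum 1 N (fun k2 => fsum 1 N (fun k3 =>
    if Nat.eqb (2 * k1 + k2 + k3) N then f k1 k2 k3 else 0))).

(* Main.v *)
From Stdlib Require Import Lra Lia.
Require Import Defs.

(** Let [A s] be the sum over [a] of [1 / (a - 1/2) - 1 / (a - 1/2 - s)], [B s] the sum of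
    [1 / (b - 1/2 - s) ^ p], and [C s = pi cot (pi s)].  The identity says that the residues
    of [A s * B s * C s / s ^ q] add up to zero: the poles at the nonzero integers give the
    left-hand side and [Shat1], because [A n = h_|n|]; the poles at the half-integers, where
    [C] vanishes, and at [0] give the products of zeta values.

    No contour is needed.  Summing over the integers [x] first, the partial fractions of
    [1 / (x ^ q (beta - x) ^ p)] reduce everything to the sums of [h_|x| / x ^ j] and of
    [h_|x| / (beta - x) ^ j].  In those, [h_|x|] is expanded as the series [A x], and after
    exchanging the two sums a second partial fraction decomposition leaves only the sums of
    [1 / x ^ i] and [1 / (beta - x) ^ i] over all integers [x], the latter being independent
    of the half-integer [beta] by translation. *)

(** * Finite sums and series of reals *)

Lemma fsum_ext i j a b :
  (forall k, (i <= k <= j)%nat -> a k = b k) -> fsum i j a = fsum i j b.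
Proof. apply sum_n_m_ext_loc. Qed.

Lemma fsum_nil i j a : (j < i)%nat -> fsum i j a = 0.
Proof. apply (sum_n_m_zero (G := R_AbelianMonoid)). Qed.

Lemma fsum_last i j a :
  (i <= S j)%nat -> fsum i (S j) a = fsum i j a + a (S j).
Proof. apply (sum_n_Sm (G := R_AbelianMonoid)). Qed.

Lemma fsum_first i j a :
  (i <= j)%nat -> fsum i j a = a i + fsum (S i) j a.
Proof. apply (sum_Sn_m (G := R_AbelianMonoid)). Qed.

Lemma fsum_single i a : fsum i i a = a i.
Proof. apply (sum_n_n (G := R_AbelianMonoid)). Qed.

Lemma fsum_S i j a : fsum (S i) (S j) a = fsum i j (fun k => a (S k)).
Proof. symmetry; apply (sum_n_m_S (G := R_AbelianMonoid)). Qed.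

Lemma fsum_scal c i j a : fsum i j (fun k => c * a k) = c * fsum i j a.
Proof. apply (sum_n_m_mult_l (K := R_Ring)). Qed.

Lemma fsum_plus i j a b :
  fsum i j (fun k => a k + b k) = fsum i j a + fsum i j b.
Proof. apply (sum_n_m_plus (G := R_AbelianMonoid)). Qed.

Lemma fsum_opp i j a : fsum i j (fun k => - a k) = - fsum i j a.
Proof.
  rewrite <- (Rmult_1_l (fsum i j a)), Ropp_mult_distr_l, <- fsum_scal.
  apply fsum_ext; intros; ring.
Qed.

Lemma fsum_zero i j a : (forall k, (i <= k <= j)%nat -> a k = 0) -> fsum i j a = 0.
Proof.
  intros H; rewrite (fsum_ext i j a (fun _ => 0) H).
  apply (sum_n_m_const_zero (G := R_AbelianMonoid)).
Qed.

Lemma fsum_le i j a b : (forall k, a k <= b k) -> fsum i j a <= fsum i j b.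
Proof. apply sum_n_m_le. Qed.

Lemma fsum_Rabs i j a : Rabs (fsum i j a) <= fsum i j (fun k => Rabs (a k)).
Proof. apply (norm_sum_n_m (K := R_AbsRing) (V := R_NormedModule)). Qed.

Lemma fsum_rev n a : fsum 0 n a = fsum 0 n (fun k => a (n - k)%nat).
Proof.
  revert a; induction n as [|n IH]; intros a.
  - now rewrite !fsum_single.
  - rewrite (fsum_first 0 (S n)), fsum_S, fsum_last, IH by lia.
    replace (S n - S n)%nat with 0%nat by lia.
    rewrite Rplus_comm; f_equal.
    apply fsum_ext; intros k Hk; f_equal; lia.
Qed.

Lemma is_series_fsum a l :
  is_series a l <-> is_lim_seq (fun N => fsum 0 N a) l.
Proof. split; intros H; exact H. Qed.

Lemma is_series_eq (a b : nat -> R) (l m : R) :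
  is_series a l -> (forall n, a n = b n) -> l = m -> is_series b m.
Proof. intros H E <-; now apply (is_series_ext a). Qed.

Lemma is_series_Rplus (a b : nat -> R) (l m : R) :
  is_series a l -> is_series b m -> is_series (fun n => a n + b n) (l + m).
Proof. apply (is_series_plus (K := R_AbsRing) (V := R_NormedModule)). Qed.

Lemma is_series_Rscal c (a : nat -> R) (l : R) :
  is_series a l -> is_series (fun n => c * a n) (c * l).
Proof. apply (is_series_scal_l (K := R_AbsRing) (V := R_NormedModule)). Qed.

Lemma is_series_Ropp (a : nat -> R) (l : R) :
  is_series a l -> is_series (fun n => - a n) (- l).
Proof. apply (is_series_opp (K := R_AbsRing) (V := R_NormedModule)). Qed.

Lemma is_series_fsum_family i j (a : nat -> nat -> R) (l : nat -> R) :
  (forall k, (i <= k <= j)%nat -> is_series (a k) (l k)) ->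
  is_series (fun n => fsum i j (fun k => a k n)) (fsum i j l).
Proof.
  induction j as [|j IH]; intros H.
  - destruct i as [|i].
    + apply (is_series_eq (a 0%nat) _ (l 0%nat)); intros; rewrite ?fsum_single; auto.
    + apply (is_series_eq (fun n => 0 * 0) _ (0 * 0)); intros; rewrite ?fsum_nil by lia; try ring.
      apply is_series_fsum, (is_lim_seq_ext (fun _ => 0)).
      * intros n; symmetry; apply fsum_zero; intros; ring.
      * rewrite Rmult_0_l; apply is_lim_seq_const.
  - destruct (Nat.le_gt_cases i (S j)) as [Hi|Hi].
    + apply (is_series_eq (fun n => fsum i j (fun k => a k n) + a (S j) n) _ (fsum i j l + l (S j)));
        intros; rewrite ?fsum_last by lia; auto.
      apply is_series_Rplus; [apply IH; intros|]; apply H; lia.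
    + apply (is_series_eq (fun n => fsum i j (fun k => a k n)) _ (fsum i j l));
        intros; rewrite ?fsum_nil by lia; auto.
      assert (IH' := IH); rewrite fsum_nil in IH' by lia.
      apply IH'; intros; lia.
Qed.

Lemma ex_series_Rle (a b : nat -> R) :
  (forall n, Rabs (a n) <= b n) -> ex_series b -> ex_series a.
Proof. apply (ex_series_le (K := R_AbsRing) (V := R_CompleteNormedModule)). Qed.

Lemma ex_series_Rscal c (a : nat -> R) : ex_series a -> ex_series (fun n => c * a n).
Proof. intros [l H]; exists (c * l); now apply is_series_Rscal. Qed.

(** The partial sums of [u] increase and stay below [v 0 - v (S N)], hence below [v 0]. *)
Lemma ex_series_le_telescoping (u v : nat -> R) :
  (forall n, 0 <= u n) -> (forall n, 0 <= v n) ->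
  (forall n, u n <= v n - v (S n)) -> ex_series u.
Proof.
  intros Hu Hv Huv.
  assert (B : forall N, fsum 0 N u <= v 0%nat - v (S N)).
  { induction N as [|N IH].
    - rewrite fsum_single; apply Huv.
    - rewrite fsum_last by lia; specialize (Huv (S N)); lra. }
  destruct (ex_finite_lim_seq_incr (fun N => fsum 0 N u) (v 0%nat)) as [l Hl].
  - intros N; rewrite fsum_last by lia; specialize (Hu (S N)); lra.
  - intros N; specialize (B N); specialize (Hv (S N)); lra.
  - now exists l; apply is_series_fsum.
Qed.

Lemma is_series_telescoping (v : nat -> R) (l : R) :
  is_lim_seq v l -> is_series (fun n => v n - v (S n)) (v 0%nat - l).
Proof.
  intros H; apply is_series_fsum.
  apply (is_lim_seq_ext (fun N => v 0%nat - v (S N))).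
  - induction n as [|n IH].
    + now rewrite fsum_single.
    + rewrite fsum_last, <- IH by lia; ring.
  - apply is_lim_seq_minus'; [apply is_lim_seq_const|].
    now apply (is_lim_seq_incr_1 v).
Qed.

Lemma is_lim_seq_fsum i j (s : nat -> nat -> R) (r : nat -> R) :
  (forall k, is_lim_seq (fun N => s N k) (r k)) ->
  is_lim_seq (fun N => fsum i j (s N)) (fsum i j r).
Proof.
  intros H; induction j as [|j IH].
  - destruct i as [|i].
    + apply (is_lim_seq_ext (fun N => s N 0%nat)); intros; rewrite ?fsum_single; auto.
    + apply (is_lim_seq_ext (fun N => 0)); intros; rewrite ?fsum_nil by lia; auto.
      apply is_lim_seq_const.
  - destruct (Nat.le_gt_cases i (S j)) as [Hi|Hi].
    + apply (is_lim_seq_ext (fun N => fsum i j (s N) + s N (S j)));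
        intros; rewrite ?fsum_last by lia; auto.
      now apply is_lim_seq_plus'.
    + apply (is_lim_seq_ext (fun N => 0)); intros; rewrite ?fsum_nil by lia; auto.
      apply is_lim_seq_const.
Qed.

Lemma Series_tail_Rabs_le (a M : nat -> R) K :
  ex_series M -> (forall n, Rabs (a n) <= M n) ->
  Rabs (Series a - fsum 0 K a) <= Series M - fsum 0 K M.
Proof.
  intros HM H.
  assert (Ha : is_series a (Series a)) by (apply Series_correct; now apply (ex_series_Rle a M)).
  apply Series_correct in HM.
  apply is_series_fsum in Ha; apply is_series_fsum in HM.
  assert (B : forall j, Rabs (fsum 0 (j + K) a - fsum 0 K a) <= fsum 0 (j + K) M - fsum 0 K M).
  { induction j as [|j IH].
    - simpl; rewrite !Rminus_diag, Rabs_R0; lra.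
    - cbn [Nat.add]; rewrite !fsum_last by lia.
      replace (fsum 0 (j + K) a + a (S (j + K)) - fsum 0 K a)
        with ((fsum 0 (j + K) a - fsum 0 K a) + a (S (j + K))) by ring.
      eapply Rle_trans; [apply Rabs_triang|]; specialize (H (S (j + K))); lra. }
  apply (is_lim_seq_le _ _ (Finite _) (Finite _) B).
  - apply (is_lim_seq_abs _ (Finite _)), is_lim_seq_minus'; [|apply is_lim_seq_const].
    now apply -> (is_lim_seq_incr_n (fun N => fsum 0 N a) K).
  - apply is_lim_seq_minus'; [|apply is_lim_seq_const].
    now apply -> (is_lim_seq_incr_n (fun N => fsum 0 N M) K).
Qed.

(** Dominated convergence for series: past a rank [K] fixed by [M], the tails of [r] and of every
    [s N] are small uniformly in [N], and the finite heads converge term by term. *)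
Lemma tannery (s : nat -> nat -> R) (r M : nat -> R) :
  ex_series M -> (forall N n, Rabs (s N n) <= M n) ->
  (forall n, is_lim_seq (fun N => s N n) (r n)) ->
  is_lim_seq (fun N => Series (s N)) (Series r).
Proof.
  intros HM Hs Hr.
  assert (Hrb : forall n, Rabs (r n) <= M n).
  { intros n.
    apply (is_lim_seq_le (fun N => Rabs (s N n)) (fun _ => M n) (Finite _) (Finite _));
      [intros N; apply Hs| |apply is_lim_seq_const].
    now apply (is_lim_seq_abs _ (Finite _)). }
  apply is_lim_seq_spec; intros eps.
  (* One third for the tail of [s N], one for the tail of [r], one for the difference of the
     heads. *)
  assert (He : 0 < eps / 3) by (destruct eps; simpl; lra).
  destruct (proj1 (is_series_fsum _ _) (Series_correct _ HM)
     (ball (Series M) (eps / 3)) (locally_ball (Series M) (mkposreal _ He))) as [K HK].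
  specialize (HK K (Nat.le_refl K)).
  assert (T : Series M - fsum 0 K M < eps / 3).
  { change (Rabs (fsum 0 K M - Series M) < eps / 3) in HK.
    apply Rabs_def2 in HK; lra. }
  assert (F := is_lim_seq_fsum 0 K s r Hr).
  apply is_lim_seq_spec in F; destruct (F (mkposreal _ He)) as [N0 HN0]; simpl in HN0.
  exists N0; intros N HN; specialize (HN0 N HN).
  assert (T1 := Series_tail_Rabs_le (s N) M K HM (Hs N)).
  assert (T2 := Series_tail_Rabs_le r M K HM Hrb).
  apply Rabs_def2 in HN0; apply Rabs_le_between in T1; apply Rabs_le_between in T2.
  apply Rabs_def1; lra.
Qed.

(** Tannery's theorem applied to the partial sums of the rows. The domination is asked of these
    partial sums, uniformly in their length, which is the form in which the kernel is bounded
    below. *)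
Lemma is_series_exchange (f : nat -> nat -> R) (r c M : nat -> R) :
  ex_series M -> (forall n N, Rabs (fsum 0 N (f n)) <= M n) ->
  (forall n, is_series (f n) (r n)) ->
  (forall a, is_series (fun n => f n a) (c a)) ->
  is_series c (Series r).
Proof.
  intros HM Hb Hr Hc; apply is_series_fsum.
  apply (is_lim_seq_ext (fun N => Series (fun n => fsum 0 N (f n)))).
  - intros N; apply is_series_unique.
    apply (is_series_fsum_family 0 N (fun a n => f n a)); intros; apply Hc.
  - apply (tannery (fun N n => fsum 0 N (f n)) r M); auto.
Qed.

(** * Half-integers and the summability estimates *)

(** The half-integer [k - 1/2] at [k = n + 1], so that sums over half-integers start at index 0. *)
Definition hf (n : nat) : R := INR n + / 2.

Lemma hf_pos n : 0 < hf n.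
Proof. unfold hf; assert (H := pos_INR n); lra. Qed.

Lemma hf_S n : hf (S n) = hf n + 1.
Proof. unfold hf; rewrite S_INR; ring. Qed.

Lemma INR_S_half n : INR (S n) - 1 / 2 = hf n.
Proof. unfold hf; rewrite S_INR; lra. Qed.

Lemma INR_S_pos n : 0 < INR (S n).
Proof. apply lt_0_INR; lia. Qed.

Lemma hnum_0 p : hnum p 0 = 0.
Proof. apply fsum_nil; lia. Qed.

Lemma hnum_S p n : hnum p (S n) = hnum p n + / hf n ^ p.
Proof. unfold hnum; rewrite fsum_last, INR_S_half by lia; reflexivity. Qed.

Lemma Hnum_0 p : Hnum p 0 = 0.
Proof. apply fsum_nil; lia. Qed.

Lemma Hnum_S p n : Hnum p (S n) = Hnum p n + / INR (S n) ^ p.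
Proof. unfold Hnum; rewrite fsum_last by lia; reflexivity. Qed.

Lemma hf_pow_inv_pos p n : 0 < / hf n ^ p.
Proof. apply Rinv_0_lt_compat, pow_lt, hf_pos. Qed.

Lemma INR_S_pow_inv_pos p n : 0 < / INR (S n) ^ p.
Proof. apply Rinv_0_lt_compat, pow_lt, INR_S_pos. Qed.

Lemma hnum_nonneg p n : 0 <= hnum p n.
Proof.
  induction n as [|n IH]; [rewrite hnum_0; lra|].
  rewrite hnum_S; assert (H := hf_pow_inv_pos p n); lra.
Qed.

Lemma Hnum_nonneg p n : 0 <= Hnum p n.
Proof.
  induction n as [|n IH]; [rewrite Hnum_0; lra|].
  rewrite Hnum_S; assert (H := INR_S_pow_inv_pos p n); lra.
Qed.

Lemma hnum_S_ge2 n : 2 <= hnum 1 (S n).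
Proof.
  induction n as [|n IH].
  - rewrite hnum_S, hnum_0; unfold hf; simpl; lra.
  - rewrite hnum_S; assert (H := hf_pow_inv_pos 1 (S n)); lra.
Qed.

(** Each of the [r - 2] extra factors [/ x] is at most 2. This reduces all the domination estimates
    to exponent 2. *)
Lemma inv_pow_le_inv_sqr x r : / 2 <= x -> (2 <= r)%nat -> / x ^ r <= 2 ^ (r - 2) * / x ^ 2.
Proof.
  intros Hx Hr.
  replace r with ((r - 2) + 2)%nat at 1 by lia.
  rewrite pow_add, Rinv_mult.
  apply Rmult_le_compat_r; [left; apply Rinv_0_lt_compat, pow_lt; lra|].
  rewrite <- pow_inv; apply pow_incr; split.
  - left; apply Rinv_0_lt_compat; lra.
  - rewrite <- (Rinv_inv 2); apply Rinv_le_contravar; lra.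
Qed.

(* [(hnum 1 n + 3) / hf n] decreases by at least the general term. *)
Lemma ex_series_hnum_div_sqr : ex_series (fun n => hnum 1 (S n) * / INR (S n) ^ 2).
Proof.
  apply (ex_series_le_telescoping _ (fun n => (hnum 1 n + 3) / hf n)).
  - intros n; apply Rmult_le_pos; [apply hnum_nonneg|left; apply INR_S_pow_inv_pos].
  - intros n; apply Rmult_le_pos; [assert (H := hnum_nonneg 1 n); lra|].
    left; apply Rinv_0_lt_compat, hf_pos.
  - intros n; assert (H := hnum_nonneg 1 (S n)).
    assert (E : hnum 1 n = hnum 1 (S n) - / hf n) by (rewrite hnum_S, pow_1; ring).
    rewrite E; set (h := hnum 1 (S n)) in *; clearbody h.
    rewrite hf_S; unfold hf; rewrite S_INR.
    assert (Hx := pos_INR n); set (x := INR n) in *; clearbody x; clear n E.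
    (* Since [(x + 1/2) (x + 3/2) <= (x + 1) ^ 2], a larger term is compared instead, whose part in
       [h] telescopes exactly. The constant 3 is the least one that keeps the remainder nonnegative
       at [x = 0]. *)
    apply Rle_trans with (h * / ((x + /2) * (x + / 2 + 1))).
    + apply Rmult_le_compat_l; auto; apply Rinv_le_contravar; nra.
    + apply Rminus_le_0.
      replace ((h - / (x + / 2) + 3) / (x + / 2) - (h + 3) / (x + / 2 + 1) -
        h * / ((x + / 2) * (x + / 2 + 1))) with (2 * x * / ((x + / 2) ^ 2 * (x + / 2 + 1))).
      * apply Rmult_le_pos; [lra|]; left; apply Rinv_0_lt_compat.
        apply Rmult_lt_0_compat; [apply pow_lt|]; lra.
      * field; split; lra.
Qed.

Lemma ex_series_hnum_div_pow r :
  (2 <= r)%nat -> ex_series (fun n => hnum 1 (S n) * / INR (S n) ^ r).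
Proof.
  intros Hr.
  apply (ex_series_Rle _ (fun n => 2 ^ (r - 2) * (hnum 1 (S n) * / INR (S n) ^ 2))).
  2: apply ex_series_Rscal, ex_series_hnum_div_sqr.
  intros n; rewrite Rabs_pos_eq.
  - replace (2 ^ (r - 2) * (hnum 1 (S n) * / INR (S n) ^ 2))
      with (hnum 1 (S n) * (2 ^ (r - 2) * / INR (S n) ^ 2)) by ring.
    apply Rmult_le_compat_l; [apply hnum_nonneg|].
    apply inv_pow_le_inv_sqr; auto.
    assert (H := pos_INR n); rewrite S_INR; lra.
  - apply Rmult_le_pos; [apply hnum_nonneg|left; apply INR_S_pow_inv_pos].
Qed.

Lemma hnum_weighted_ex_series (g : nat -> R) K :
  (forall n, Rabs (g n) <= K * / INR (S n) ^ 2) ->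
  ex_series (fun n => hnum 1 (S n) * g n).
Proof.
  intros H; apply (ex_series_Rle _ (fun n => K * (hnum 1 (S n) * / INR (S n) ^ 2))).
  2: apply ex_series_Rscal, ex_series_hnum_div_sqr.
  intros n; rewrite Rabs_mult, (Rabs_pos_eq (hnum 1 (S n))) by apply hnum_nonneg.
  assert (H1 := hnum_nonneg 1 (S n)); specialize (H n).
  replace (K * (hnum 1 (S n) * / INR (S n) ^ 2))
    with (hnum 1 (S n) * (K * / INR (S n) ^ 2)) by ring.
  now apply Rmult_le_compat_l.
Qed.

(** The factor 4 comes from [INR (S n) <= 2 * hf n], squared. *)
Lemma hf_inv_pow_le r n :
  (2 <= r)%nat -> / hf n ^ r <= 2 ^ (r - 2) * 4 * / INR (S n) ^ 2.
Proof.
  intros Hr; assert (Hn := pos_INR n).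
  eapply Rle_trans; [apply inv_pow_le_inv_sqr; auto; unfold hf; lra|].
  rewrite Rmult_assoc; apply Rmult_le_compat_l; [apply pow_le; lra|].
  replace (4 * / INR (S n) ^ 2) with (/ (INR (S n) / 2) ^ 2)
    by (field; apply not_0_INR; lia).
  assert (H := INR_S_pos n).
  apply Rinv_le_contravar; [apply pow_lt; lra|].
  apply pow_incr; unfold hf; rewrite S_INR in *; lra.
Qed.

(** Termwise comparison; the index [S n] on the right matches the series of
    [ex_series_hnum_div_sqr], which then dominates the series with [Hnum] over powers of [hf]. *)
Lemma Hnum_le_hnum k n : (1 <= k)%nat -> Hnum k n <= hnum 1 (S n).
Proof.
  intros Hk; apply Rle_trans with (hnum 1 n).
  2: rewrite hnum_S; assert (H := hf_pow_inv_pos 1 n); lra.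
  induction n as [|n IH]; [rewrite Hnum_0, hnum_0; lra|].
  rewrite Hnum_S, hnum_S; apply Rplus_le_compat; auto.
  assert (Hn := pos_INR n).
  apply Rle_trans with (/ INR (S n) ^ 1).
  - apply Rinv_le_contravar; [apply pow_lt, INR_S_pos|].
    apply Rle_pow; auto; rewrite S_INR; lra.
  - apply Rinv_le_contravar; [apply pow_lt, hf_pos|].
    rewrite !pow_1; unfold hf; rewrite S_INR; lra.
Qed.

Lemma ex_series_Hnum_div_hf k r :
  (1 <= k)%nat -> (2 <= r)%nat -> ex_series (fun n => Hnum k n * / hf n ^ r).
Proof.
  intros Hk Hr.
  apply (ex_series_Rle _ (fun n => 2 ^ (r - 2) * 4 * (hnum 1 (S n) * / INR (S n) ^ 2))).
  2: apply ex_series_Rscal, ex_series_hnum_div_sqr.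
  intros n; rewrite Rabs_pos_eq.
  - replace (2 ^ (r - 2) * 4 * (hnum 1 (S n) * / INR (S n) ^ 2))
      with (hnum 1 (S n) * (2 ^ (r - 2) * 4 * / INR (S n) ^ 2)) by ring.
    apply Rmult_le_compat; [apply Hnum_nonneg|left; apply hf_pow_inv_pos| |].
    + now apply Hnum_le_hnum.
    + now apply hf_inv_pow_le.
  - apply Rmult_le_pos; [apply Hnum_nonneg|left; apply hf_pow_inv_pos].
Qed.

Lemma ex_series_inv_pow r : (2 <= r)%nat -> ex_series (fun n => / INR (S n) ^ r).
Proof.
  intros Hr; apply (ex_series_Rle _ (fun n => hnum 1 (S n) * / INR (S n) ^ r)).
  2: now apply ex_series_hnum_div_pow.
  intros n; assert (H1 := hnum_S_ge2 n); assert (H2 := INR_S_pow_inv_pos r n).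
  rewrite Rabs_pos_eq by lra; nra.
Qed.

Lemma is_series_zeta r : (2 <= r)%nat -> is_series (fun n => / INR (S n) ^ r) (zeta r).
Proof. intros Hr; now apply Series_correct, ex_series_inv_pow. Qed.

Lemma is_series_ttilde r : (2 <= r)%nat -> is_series (fun n => / hf n ^ r) (ttilde r).
Proof.
  intros Hr; unfold ttilde, Series1.
  rewrite (Series_ext _ (fun n => / hf n ^ r)) by (intros n; now rewrite INR_S_half).
  apply Series_correct.
  apply (ex_series_Rle _ (fun n => 2 ^ (r - 2) * 4 * / INR (S n) ^ 2)).
  2: now apply ex_series_Rscal, ex_series_inv_pow.
  intros n; rewrite Rabs_pos_eq by (left; apply hf_pow_inv_pos).
  now apply hf_inv_pow_le.
Qed.

(** * Symmetric sums over the integers *)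

Definition pm (f : R -> R) (n : nat) : R := f (INR (S n)) + f (- INR (S n)).

(** Symmetric summation over all integers, as for the partial fractions of the cotangent: pairing
    [x] with [- x] makes the sums of first order converge. The total [l] includes the term at 0. *)
Definition is_zsum (f : R -> R) (l : R) : Prop := is_series (pm f) (l - f 0).

Lemma is_zsum_opp f l : is_zsum f l -> is_zsum (fun x => f (- x)) l.
Proof.
  intros H; apply (is_series_eq _ _ _ _ H).
  - intros n; unfold pm; rewrite Ropp_involutive; ring.
  - now rewrite Ropp_0.
Qed.

Lemma is_zsum_ext f g l : (forall x, f x = g x) -> is_zsum f l -> is_zsum g l.
Proof.
  intros E H; apply (is_series_eq _ _ _ _ H).
  - intros n; unfold pm; now rewrite !E.
  - now rewrite E.
Qed.

(* Symmetric partial sums of [f] and of its translate differ by two boundary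
   terms, so absolute convergence is not needed. *)
Lemma is_zsum_shift f l :
  is_lim_seq (fun n => f (INR n)) 0 -> is_lim_seq (fun n => f (- INR n)) 0 ->
  is_zsum f l -> is_zsum (fun x => f (x + 1)) l.
Proof.
  intros Hp Hn H; unfold is_zsum in *; apply is_series_fsum in H; apply is_series_fsum.
  apply (is_lim_seq_ext (fun N => (fsum 0 N (pm f) + (f 0 - f 1)) +
     (f (INR (S (S N))) - f (- INR (S N))))).
  - intros N; induction N as [|N IH].
    + rewrite !fsum_single; unfold pm; simpl.
      replace (- (1) + 1) with 0 by ring; ring.
    + rewrite !fsum_last, <- IH by lia; unfold pm.
      rewrite <- (S_INR (S (S N))).
      replace (- INR (S (S N)) + 1) with (- INR (S N)) by (rewrite (S_INR (S N)); ring).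
      ring.
  - replace (Finite (l - f (0 + 1))) with (Finite ((l - f 0 + (f 0 - f 1)) + (0 - 0)))
      by (f_equal; rewrite Rplus_0_l; ring).
    apply is_lim_seq_plus'; [apply is_lim_seq_plus'; auto; apply is_lim_seq_const|].
    apply is_lim_seq_minus'.
    + now apply (is_lim_seq_incr_n (fun n => f (INR n)) 2) in Hp;
        apply (is_lim_seq_ext _ _ _ (fun n => f_equal (fun k => f (INR k)) (Nat.add_comm n 2))).
    + now apply (is_lim_seq_incr_1 (fun n => f (- INR n))).
Qed.

Lemma is_lim_seq_inv_INR c : is_lim_seq (fun n => / (INR n + c)) 0.
Proof.
  apply (is_lim_seq_inv _ p_infty); [|easy].
  apply (is_lim_seq_plus _ _ p_infty (Finite c)); [apply is_lim_seq_INR|apply is_lim_seq_const|easy].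
Qed.

Lemma is_lim_seq_pow_S u i : is_lim_seq u 0 -> is_lim_seq (fun n => u n ^ S i) 0.
Proof.
  intros H; induction i as [|i IH].
  - apply (is_lim_seq_ext u); auto; intros; simpl; ring.
  - replace (Finite 0) with (Finite (0 * 0)) by (f_equal; ring).
    apply (is_lim_seq_mult' u (fun n => u n ^ S i)); auto.
Qed.

Lemma inv_opp_pow x k : / (- x) ^ k = (-1) ^ k * / x ^ k.
Proof.
  replace (- x) with (-1 * x) by ring.
  rewrite Rpow_mult_distr, Rinv_mult, <- pow_inv; do 2 f_equal; lra.
Qed.

(* [gam i] is the sum of [(m - 1/2) ^ - (i + 1)] over all integers [m]; at [i = 0] the
   junk value [ttilde 1] has coefficient [0]. *)
Definition gam (i : nat) : R := (1 - (-1) ^ i) * ttilde (i + 1).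

Lemma gam_0 : gam 0 = 0.
Proof. unfold gam; simpl; ring. Qed.

(** Negative integers give the same half-integers with a sign. For [i = 0] the pairs telescope to
    the opposite of the central term; for larger [i] both halves converge separately. *)
Lemma is_zsum_half i : is_zsum (fun x => / (x + / 2) ^ S i) (gam i).
Proof.
  assert (P : forall n, pm (fun x => / (x + / 2) ^ S i) n
                = / hf (S n) ^ S i + (-1) ^ S i * / hf n ^ S i).
  { intros n; unfold pm; f_equal; rewrite <- inv_opp_pow; do 2 f_equal.
    unfold hf; rewrite S_INR; field. }
  unfold is_zsum; rewrite Rplus_0_l; destruct i as [|i].
  - rewrite gam_0; apply (is_series_eq (fun n => - (/ hf n - / hf (S n))) _ (- (/ hf 0 - 0))).
    + apply is_series_Ropp, (is_series_telescoping (fun n => / hf n)), is_lim_seq_inv_INR.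
    + intros n; rewrite P; simpl; rewrite !Rmult_1_r; ring.
    + unfold hf; simpl; rewrite Rplus_0_l, Rmult_1_r; ring.
  - assert (T := is_series_ttilde (S (S i)) ltac:(lia)).
    apply (is_series_eq (fun n => / hf (S n) ^ S (S i) + (-1) ^ S (S i) * / hf n ^ S (S i)) _
      ((ttilde (S (S i)) - / hf 0 ^ S (S i)) + (-1) ^ S (S i) * ttilde (S (S i)))).
    + apply is_series_Rplus; [|now apply is_series_Rscal].
      apply (is_series_incr_1 (fun n => / hf n ^ S (S i))).
      unfold plus; simpl AbelianMonoid.plus; simpl.
      apply (is_series_eq _ _ _ _ T); auto; simpl; ring.
    + intros n; now rewrite P.
    + unfold gam, hf; rewrite Rplus_0_l, Nat.add_1_r; simpl; ring.
Qed.

(** After the reflection of [x], raising [b] by one is a translation by one, so the value at [b = 0]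
    persists. *)
Lemma is_zsum_gam i b : is_zsum (fun x => / (hf b - x) ^ S i) (gam i).
Proof.
  apply (is_zsum_ext (fun x => (fun y => / (y + hf b) ^ S i) (- x))).
  { intros x; do 2 f_equal; ring. }
  apply (is_zsum_opp (fun y => / (y + hf b) ^ S i)); induction b as [|b IH].
  - apply (is_zsum_ext (fun x => / (x + / 2) ^ S i)); [|apply is_zsum_half].
    intros x; unfold hf; simpl; rewrite Rplus_0_l; reflexivity.
  - apply (is_zsum_ext (fun x => / ((x + 1) + hf b) ^ S i)).
    { intros x; rewrite hf_S; do 2 f_equal; ring. }
    apply (is_zsum_shift (fun y => / (y + hf b) ^ S i)); auto.
    + apply (is_lim_seq_ext (fun n => (/ (INR n + hf b)) ^ S i)).
      { intros n; apply pow_inv. }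
      apply is_lim_seq_pow_S, is_lim_seq_inv_INR.
    + apply (is_lim_seq_ext (fun n => (- / (INR n + - hf b)) ^ S i)).
      { intros n; rewrite <- pow_inv; f_equal.
        rewrite <- Rinv_opp; f_equal; ring. }
      apply is_lim_seq_pow_S.
      replace 0 with (- 0) by ring.
      apply (is_lim_seq_opp _ (Finite 0)), is_lim_seq_inv_INR.
Qed.

Lemma is_series_pm_hf i b :
  is_series (pm (fun x => / (hf b - x) ^ S i)) (gam i - / hf b ^ S i).
Proof.
  apply (is_series_eq _ _ _ _ (is_zsum_gam i b)); auto; now rewrite Rminus_0_r.
Qed.

(** Counterpart of [gam] for the nonzero integers: the symmetric sum of [/ x ^ S i]. At [i = 0] the
    coefficient 0 removes the junk value [zeta 1]. *)
Definition zbar (i : nat) : R := (1 - (-1) ^ i) * zeta (i + 1).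

Lemma is_series_pm_pow i : is_series (pm (fun x => / x ^ S i)) (zbar i).
Proof.
  assert (P : forall n, pm (fun x => / x ^ S i) n = (1 - (-1) ^ i) * / INR (S n) ^ S i).
  { intros n; unfold pm; rewrite inv_opp_pow; simpl ((-1) ^ S i); ring. }
  destruct i as [|i].
  (* The pairs cancel; the zero series is presented as 0 times a convergent one. *)
  - apply (is_series_eq (fun n => 0 * / INR (S n) ^ 2) _ (0 * zeta 2)).
    + apply is_series_Rscal, is_series_zeta; lia.
    + intros n; rewrite P; simpl; ring.
    + unfold zbar; simpl; ring.
  - unfold zbar; rewrite Nat.add_1_r.
    apply (is_series_eq (fun n => (1 - (-1) ^ S i) * / INR (S n) ^ S (S i)) _
      ((1 - (-1) ^ S i) * zeta (S (S i)))); auto.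
    apply is_series_Rscal, is_series_zeta; lia.
Qed.

(** * Partial fractions *)

(** The part in powers of [y] of the partial fraction decomposition of [y ^ S q * z ^ S p], where
    typically [y = 1 / x], [z = 1 / (beta - x)] and [e = 1 / beta]. *)
Definition pf_part (p q : nat) (e y : R) : R :=
  fsum 0 q (fun j => binom (p + q - j) p * e ^ S (p + q - j) * y ^ S j).

Lemma binom_0 n : binom n 0 = 1.
Proof. apply C_n_0. Qed.

Lemma binom_diag n : binom n n = 1.
Proof. apply C_n_n. Qed.

Lemma pf_part_0 q e y :
  pf_part 0 q e y = fsum 0 q (fun j => e ^ S (q - j) * y ^ S j).
Proof. apply fsum_ext; intros j Hj; rewrite binom_0; simpl (0 + q)%nat; ring. Qed.

Lemma pf_part_single p e y : pf_part p 0 e y = e ^ S p * y.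
Proof.
  unfold pf_part; rewrite fsum_single, Nat.add_0_r, Nat.sub_0_r, binom_diag, pow_1; ring.
Qed.

(** Pascal's rule on the coefficients. The top term [j = S q] is split off first, because only
    [pf_part p (S q)] contributes to it. *)
Lemma pf_part_rec p q e y :
  pf_part (S p) (S q) e y = e * (pf_part p (S q) e y + pf_part (S p) q e y).
Proof.
  unfold pf_part; rewrite !fsum_last by lia.
  replace (S p + S q - S q)%nat with (S p) by lia.
  replace (p + S q - S q)%nat with p by lia.
  rewrite !binom_diag.
  rewrite (fsum_ext 0 q (fun j => binom (S p + S q - j) (S p) * e ^ S (S p + S q - j) * y ^ S j)
    (fun j => e * (binom (p + S q - j) p * e ^ S (p + S q - j) * y ^ S j)
       + e * (binom (S p + q - j) (S p) * e ^ S (S p + q - j) * y ^ S j))).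
  - rewrite fsum_plus, !fsum_scal; simpl; ring.
  - intros j Hj.
    replace (S p + S q - j)%nat with (S (p + S q - j)) by lia.
    replace (S p + q - j)%nat with (p + S q - j)%nat by lia.
    unfold binom; rewrite <- pascal by lia; simpl; ring.
Qed.

(** The hypothesis is [1 / (x (beta - x)) = (1 / x + 1 / (beta - x)) / beta] with the denominators
    hidden, so that the same algebra serves for several pairs of poles. *)
Lemma partial_fractions_simple q e y z :
  y * z = e * (y + z) -> y ^ S q * z = pf_part 0 q e y + e ^ S q * z.
Proof.
  intros H; rewrite pf_part_0; induction q as [|q IH].
  - rewrite fsum_single; simpl; rewrite !Rmult_1_r, H; ring.
  - rewrite fsum_first by lia; rewrite fsum_S, Nat.sub_0_r.
    rewrite (fsum_ext 0 q _ (fun j => y * (e ^ S (q - j) * y ^ S j)))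
      by (intros j _; simpl; ring).
    rewrite fsum_scal.
    replace (y ^ S (S q) * z) with (y * (y ^ S q * z)) by (simpl; ring).
    rewrite IH, Rmult_plus_distr_l.
    replace (y * (e ^ S q * z)) with (e ^ S q * (y * z)) by ring.
    rewrite H; simpl; ring.
Qed.

(** Double induction: one use of the relation between [y] and [z] lowers either exponent by one, and
    [pf_part_rec] follows the same recursion. *)
Lemma partial_fractions p q e y z :
  y * z = e * (y + z) ->
  y ^ S q * z ^ S p = pf_part p q e y + pf_part q p e z.
Proof.
  intros H; revert q; induction p as [|p IHp]; intros q.
  - rewrite pf_part_single, pow_1; now apply partial_fractions_simple.
  - induction q as [|q IHq].
    + rewrite pf_part_single, pow_1, Rmult_comm, (partial_fractions_simple (S p) e z y); [ring|].
      rewrite Rmult_comm, H; ring.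
    + rewrite !pf_part_rec.
      transitivity (e * (y ^ S (S q) * z ^ S p + y ^ S q * z ^ S (S p))).
      * replace (y ^ S (S q) * z ^ S (S p)) with (y ^ S q * z ^ S p * (y * z)) by (simpl; ring).
        rewrite H; simpl; ring.
      * rewrite IHp, IHq; ring.
Qed.

(** * The kernel: odd harmonic numbers as limits of finite sums of simple fractions *)

(** Truncation of the series [A x], whose value at an integer [x] is the odd harmonic number of
    index [|x|]. *)
Definition kernel (N : nat) (x : R) : R := fsum 0 N (fun a => / hf a - / (hf a - x)).

Lemma hf_minus_INR_ge b n : / 2 <= Rabs (hf b - INR n).
Proof.
  unfold hf; destruct (Nat.le_gt_cases n b) as [H|H].
  - apply le_INR in H; rewrite Rabs_pos_eq; lra.
  - apply le_INR in H; rewrite S_INR in H; rewrite Rabs_left; lra.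
Qed.

(** The arguments are shifted by one: one enters at the lower end and one leaves at the upper end.
    The general [f] covers inverses, inverse powers and their absolute values. *)
Lemma fsum_hf_minus (f : R -> R) N n :
  fsum 0 N (fun a => f (hf a - INR (S n))) =
  fsum 0 N (fun a => f (hf a - INR n)) + f (- hf n) - f (hf N - INR n).
Proof.
  induction N as [|N IH].
  - rewrite !fsum_single; replace (hf 0 - INR (S n)) with (- hf n); [ring|].
    unfold hf; rewrite S_INR; simpl; field.
  - rewrite !fsum_last, IH, hf_S by lia.
    replace (hf N + 1 - INR (S n)) with (hf N - INR n) by (rewrite S_INR; ring); ring.
Qed.

Lemma fsum_hf_plus (f : R -> R) N n :
  fsum 0 N (fun a => f (hf a + INR (S n))) =
  fsum 0 N (fun a => f (hf a + INR n)) - f (hf n) + f (hf (S N) + INR n).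
Proof.
  induction N as [|N IH].
  - rewrite !fsum_single, hf_S; replace (hf 0 + INR n) with (hf n)
      by (unfold hf; simpl; ring).
    replace (hf 0 + INR (S n)) with (hf 0 + 1 + INR n) by (rewrite S_INR; ring); ring.
  - rewrite !fsum_last, IH by lia.
    replace (hf (S N) + INR (S n)) with (hf (S (S N)) + INR n)
      by (rewrite S_INR, (hf_S (S N)); ring); ring.
Qed.

Lemma kernel_split N x :
  kernel N x = fsum 0 N (fun a => / hf a) - fsum 0 N (fun a => / (hf a - x)).
Proof.
  unfold kernel, Rminus at 3; rewrite <- fsum_opp; apply fsum_plus.
Qed.

Lemma kernel_0 N : kernel N 0 = 0.
Proof. apply fsum_zero; intros a _; rewrite Rminus_0_r; ring. Qed.

Lemma kernel_S N n :
  kernel N (INR (S n)) = kernel N (INR n) + / hf n + / (hf N - INR n).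
Proof.
  rewrite !kernel_split, (fsum_hf_minus Rinv), Rinv_opp; ring.
Qed.

Lemma kernel_opp_S N n :
  kernel N (- INR (S n)) = kernel N (- INR n) + / hf n - / (hf (S N) + INR n).
Proof.
  assert (E : forall m, fsum 0 N (fun a => / (hf a - - INR m)) =
    fsum 0 N (fun a => / (hf a + INR m))).
  { intros m; apply fsum_ext; intros a _; f_equal; ring. }
  rewrite !kernel_split, !E, (fsum_hf_plus Rinv); ring.
Qed.

(** Raising [n] by one adds [/ hf n] and a boundary term that vanishes as [N] grows. *)
Lemma kernel_lim n : is_lim_seq (fun N => kernel N (INR n)) (hnum 1 n).
Proof.
  induction n as [|n IH].
  - rewrite hnum_0; apply (is_lim_seq_ext (fun _ => 0)); [|apply is_lim_seq_const].
    intros N; symmetry; apply kernel_0.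
  - apply (is_lim_seq_ext _ _ _ (fun N => eq_sym (kernel_S N n))).
    replace (hnum 1 (S n)) with (hnum 1 n + / hf n + 0) by (rewrite hnum_S, pow_1; ring).
    apply is_lim_seq_plus'; [apply is_lim_seq_plus'; auto; apply is_lim_seq_const|].
    apply (is_lim_seq_ext (fun N => / (INR N + (/ 2 - INR n)))); [|apply is_lim_seq_inv_INR].
    intros N; f_equal; unfold hf; ring.
Qed.

Lemma kernel_opp_lim n : is_lim_seq (fun N => kernel N (- INR n)) (hnum 1 n).
Proof.
  induction n as [|n IH].
  - rewrite hnum_0; apply (is_lim_seq_ext (fun _ => 0)); [|apply is_lim_seq_const].
    intros N; symmetry; change (INR 0) with 0; rewrite Ropp_0; apply kernel_0.
  - apply (is_lim_seq_ext _ _ _ (fun N => eq_sym (kernel_opp_S N n))).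
    replace (hnum 1 (S n)) with (hnum 1 n + / hf n - 0) by (rewrite hnum_S, pow_1; ring).
    apply is_lim_seq_minus'; [apply is_lim_seq_plus'; auto; apply is_lim_seq_const|].
    apply (is_lim_seq_ext (fun N => / (INR N + (1 + / 2 + INR n)))); [|apply is_lim_seq_inv_INR].
    intros N; f_equal; rewrite hf_S; unfold hf; ring.
Qed.

Lemma hnum_le p m n : (m <= n)%nat -> hnum p m <= hnum p n.
Proof.
  induction 1 as [|n H IH]; [lra|].
  rewrite hnum_S; assert (P := hf_pow_inv_pos p n); lra.
Qed.

(** The terms [/ hf] decrease, so a block of [n] terms is largest at the start. *)
Lemma hnum_subadditive m n : hnum 1 (m + n) <= hnum 1 m + hnum 1 n.
Proof.
  induction n as [|n IH]; [rewrite Nat.add_0_r, hnum_0; lra|].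
  rewrite Nat.add_succ_r, !hnum_S, !pow_1.
  enough (/ hf (m + n) <= / hf n) by lra.
  apply Rinv_le_contravar; [apply hf_pos|].
  unfold hf; rewrite plus_INR; assert (H := pos_INR m); lra.
Qed.

(* The last index is the absolute value of [N + 1 - n]. *)
Lemma kernel_closed N n :
  kernel N (INR n) = hnum 1 (S N) + hnum 1 n - hnum 1 ((S N - n) + (n - S N)).
Proof.
  induction n as [|n IH].
  - change (INR 0) with 0; rewrite kernel_0, Nat.sub_0_r, Nat.add_0_r, hnum_0; ring.
  - rewrite kernel_S, IH, (hnum_S 1 n), pow_1.
    destruct (Nat.le_gt_cases n N) as [H|H].
    + replace (S N - n + (n - S N))%nat with (S (N - n)) by lia.
      replace (S N - S n + (S n - S N))%nat with (N - n)%nat by lia.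
      rewrite (hnum_S 1 (N - n)), pow_1.
      replace (hf N - INR n) with (hf (N - n)) by (unfold hf; rewrite minus_INR by lia; ring).
      ring.
    + replace (S N - n + (n - S N))%nat with (n - S N)%nat by lia.
      replace (S N - S n + (S n - S N))%nat with (S (n - S N)) by lia.
      rewrite (hnum_S 1 (n - S N)), pow_1.
      replace (hf N - INR n) with (- hf (n - S N))
        by (unfold hf; rewrite minus_INR, S_INR by lia; field).
      rewrite Rinv_opp; ring.
Qed.

Lemma kernel_opp_closed N n :
  kernel N (- INR n) = hnum 1 (S N) + hnum 1 n - hnum 1 (S N + n).
Proof.
  induction n as [|n IH].
  - change (INR 0) with 0; rewrite Ropp_0, kernel_0, Nat.add_0_r, hnum_0; ring.
  - rewrite kernel_opp_S, IH, Nat.add_succ_r, !hnum_S, !pow_1.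
    replace (hf (S N) + INR n) with (hf (S N + n)) by (unfold hf; rewrite plus_INR; ring).
    ring.
Qed.

(** With [d] the distance from [N + 1] to [n], subadditivity bounds the difference of [hnum 1 (S N)]
    and [hnum 1 d] by [hnum 1 n]. Uniformity in [N] is what the exchange of sums requires. *)
Lemma kernel_bound N n : Rabs (kernel N (INR n)) <= 2 * hnum 1 n.
Proof.
  rewrite kernel_closed; set (d := (S N - n + (n - S N))%nat).
  assert (H1 : hnum 1 (S N) <= hnum 1 d + hnum 1 n).
  { eapply Rle_trans; [|apply hnum_subadditive]; apply hnum_le; lia. }
  assert (H2 : hnum 1 d <= hnum 1 (S N) + hnum 1 n).
  { eapply Rle_trans; [|apply hnum_subadditive]; apply hnum_le; lia. }
  apply Rabs_le; assert (H := hnum_nonneg 1 n); lra.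
Qed.

Lemma kernel_opp_bound N n : Rabs (kernel N (- INR n)) <= 2 * hnum 1 n.
Proof.
  rewrite kernel_opp_closed.
  assert (H1 := hnum_subadditive (S N) n).
  assert (H2 : hnum 1 (S N) <= hnum 1 (S N + n)) by (apply hnum_le; lia).
  apply Rabs_le; assert (H := hnum_nonneg 1 n); lra.
Qed.

(** * Weighted symmetric sums over the nonzero integers *)

Definition nzint (x : R) : Prop := exists n, x = INR (S n) \/ x = - INR (S n).

Lemma nzint_neq0 x : nzint x -> x <> 0.
Proof. intros [n [-> | ->]]; assert (H := INR_S_pos n); lra. Qed.

Lemma nzint_Rabs_ge1 x : nzint x -> 1 <= Rabs x.
Proof.
  intros [n H]; assert (Hn := pos_INR n).
  assert (E : Rabs x = INR (S n)).
  { destruct H as [-> | ->]; [|rewrite Rabs_Ropp]; apply Rabs_pos_eq, pos_INR. }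
  rewrite E, S_INR; lra.
Qed.

Lemma nzint_hf_ge b x : nzint x -> / 2 <= Rabs (hf b - x).
Proof.
  intros [n [-> | ->]]; [apply hf_minus_INR_ge|].
  assert (H := INR_S_pos n); assert (H' := pos_INR b).
  unfold hf; rewrite Rabs_pos_eq; lra.
Qed.

Lemma nzint_hf_neq b x : nzint x -> hf b - x <> 0.
Proof.
  intros Hx E; assert (H := nzint_hf_ge b x Hx); rewrite E, Rabs_R0 in H; lra.
Qed.

(** Triangle inequality, with [hf b] absorbed by [1 <= 2 * Rabs (hf b - x)]. It turns decay in
    [hf b - x] into decay in [x]. *)
Lemma nzint_le_hf b x : nzint x -> Rabs x <= (1 + 2 * hf b) * Rabs (hf b - x).
Proof.
  intros Hx; assert (H := nzint_hf_ge b x Hx); assert (Hb := hf_pos b).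
  assert (T : Rabs x <= Rabs (hf b) + Rabs (hf b - x)).
  { replace x with (hf b - (hf b - x)) at 1 by ring.
    eapply Rle_trans; [apply Rabs_triang|]; rewrite Rabs_Ropp; lra. }
  rewrite (Rabs_pos_eq (hf b)) in T by lra; nra.
Qed.

(** Unlike in [is_zsum], the point 0 is left out, so [f] may have a pole there; [w n] is the weight
    of both integers of absolute value [n + 1]. *)
Definition wsum (w : nat -> R) (f : R -> R) (l : R) : Prop :=
  is_series (fun n => w n * pm f n) l.

Lemma wsum_eq w f g l m :
  wsum w f l -> (forall x, nzint x -> f x = g x) -> l = m -> wsum w g m.
Proof.
  intros H E ->; apply (is_series_eq _ _ _ _ H); auto.
  intros n; unfold pm; rewrite !E; auto; exists n; auto.
Qed.

Lemma wsum_plus w f g l m :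
  wsum w f l -> wsum w g m -> wsum w (fun x => f x + g x) (l + m).
Proof.
  intros Hf Hg; apply (is_series_eq _ _ _ _ (is_series_Rplus _ _ _ _ Hf Hg)); auto.
  intros n; unfold pm; ring.
Qed.

Lemma wsum_scal w c f l : wsum w f l -> wsum w (fun x => c * f x) (c * l).
Proof.
  intros Hf; apply (is_series_eq _ _ _ _ (is_series_Rscal c _ _ Hf)); auto.
  intros n; unfold pm; ring.
Qed.

Lemma wsum_fsum w i j (f : nat -> R -> R) (l : nat -> R) :
  (forall k, (i <= k <= j)%nat -> wsum w (f k) (l k)) ->
  wsum w (fun x => fsum i j (fun k => f k x)) (fsum i j l).
Proof.
  intros H.
  apply (is_series_eq _ _ _ _ (is_series_fsum_family i j (fun k n => w n * pm (f k) n) l H)); auto.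
  intros n; rewrite fsum_scal; unfold pm; now rewrite fsum_plus.
Qed.

Lemma wsum_one_hf i b :
  wsum (fun _ => 1) (fun x => / (hf b - x) ^ S i) (gam i - / hf b ^ S i).
Proof.
  apply (is_series_eq _ _ _ _ (is_series_pm_hf i b)); auto; intros; ring.
Qed.

Lemma wsum_one_pow i : wsum (fun _ => 1) (fun x => / x ^ S i) (zbar i).
Proof.
  apply (is_series_eq _ _ _ _ (is_series_pm_pow i)); auto; intros; ring.
Qed.

Notation hweight := (fun n : nat => hnum 1 (S n)).

(** The device behind the weighted sums: the weight is replaced by the limit of [kernel N], the sums
    over [a] and [x] are exchanged, and [E a] is the unweighted sum over [x] of a rational
    function. *)
Lemma kernel_sum (g : R -> R) K (E : nat -> R) l :
  (forall x, nzint x -> Rabs (g x) <= K * / x ^ 2) ->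
  (forall a, wsum (fun _ => 1) (fun x => (/ hf a - / (hf a - x)) * g x) (E a)) ->
  is_series E l ->
  wsum hweight g l.
Proof.
  intros Hg HE Hl.
  assert (Hp : forall n, Rabs (g (INR (S n))) <= K * / INR (S n) ^ 2).
  { intros n; apply Hg; exists n; auto. }
  assert (Hn : forall n, Rabs (g (- INR (S n))) <= K * / INR (S n) ^ 2).
  { intros n; replace (INR (S n) ^ 2) with ((- INR (S n)) ^ 2) by ring.
    apply Hg; exists n; auto. }
  assert (S1 : forall n N,
    fsum 0 N (fun a => 1 * pm (fun x => (/ hf a - / (hf a - x)) * g x) n) =
    g (INR (S n)) * kernel N (INR (S n)) + g (- INR (S n)) * kernel N (- INR (S n))).
  { intros n N; unfold kernel; rewrite <- !fsum_scal, <- fsum_plus.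
    apply fsum_ext; intros a _; unfold pm; ring. }
  assert (H : is_series E (Series (fun n => hnum 1 (S n) * pm g n))).
  (* The factor 4 is 2 from the kernel bounds times 2 for the two integers of each pair. *)
  { apply (is_series_exchange (fun n a => 1 * pm (fun x => (/ hf a - / (hf a - x)) * g x) n)
      _ E (fun n => 4 * K * (hnum 1 (S n) * / INR (S n) ^ 2))); auto.
    - apply ex_series_Rscal, ex_series_hnum_div_sqr.
    - intros n N; rewrite S1.
      eapply Rle_trans; [apply Rabs_triang|]; rewrite !Rabs_mult.
      assert (K1 := kernel_bound N (S n)); assert (K2 := kernel_opp_bound N (S n)).
      specialize (Hp n); specialize (Hn n).
      assert (A1 := Rmult_le_compat _ _ _ _ (Rabs_pos _) (Rabs_pos _) Hp K1).
      assert (A2 := Rmult_le_compat _ _ _ _ (Rabs_pos _) (Rabs_pos _) Hn K2).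
      lra.
    - intros n; apply is_series_fsum.
      apply (is_lim_seq_ext _ _ _ (fun N => eq_sym (S1 n N))).
      replace (hnum 1 (S n) * pm g n)
        with (g (INR (S n)) * hnum 1 (S n) + g (- INR (S n)) * hnum 1 (S n))
        by (unfold pm; ring).
      apply is_lim_seq_plus'.
      + apply (is_lim_seq_scal_l _ _ (Finite _)), kernel_lim.
      + apply (is_lim_seq_scal_l _ _ (Finite _)), kernel_opp_lim. }
  apply is_series_unique in H; apply is_series_unique in Hl.
  unfold wsum; rewrite <- Hl, H; apply Series_correct, (hnum_weighted_ex_series _ (2 * K)).
  intros n; unfold pm; eapply Rle_trans; [apply Rabs_triang|].
  specialize (Hp n); specialize (Hn n); lra.
Qed.

(** * Sums of simple fractions weighted by odd harmonic numbers *)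

Lemma Rabs_inv_pow_le x r :
  / 2 <= Rabs x -> (2 <= r)%nat -> Rabs (/ x ^ r) <= 2 ^ (r - 2) * / x ^ 2.
Proof.
  intros Hx Hr; rewrite Rabs_inv, <- RPow_abs, <- (pow2_abs x).
  now apply inv_pow_le_inv_sqr.
Qed.

Definition Wval (j : nat) : R :=
  ttilde (j + 2) - fsum 1 (j - 1) (fun i => zbar i * ttilde (S (j - i))).

(** Partial fractions at the poles 0 and [hf a]. As [gam 0 = 0], the simple pole at [hf a]
    contributes only the opposite of its missing value at [x = 0]; this produces
    [ttilde (j + 2)]. *)
Lemma hweight_sum_pow j :
  (1 <= j)%nat -> wsum hweight (fun x => / x ^ S j) (Wval j).
Proof.
  destruct j as [|j]; [lia|intros _].
  apply (kernel_sum _ (2 ^ (S (S j) - 2))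
    (fun a => / hf a ^ S (S (S j)) + -1 * fsum 0 j (fun i => zbar i * / hf a ^ S (S j - i)))).
  - intros x Hx; apply Rabs_inv_pow_le; [|lia].
    assert (H := nzint_Rabs_ge1 x Hx); lra.
  - intros a; assert (Ha := hf_pos a).
    eapply wsum_eq.
    + apply wsum_plus; [apply (wsum_scal _ (- / hf a ^ S (S j))), (wsum_one_hf 0 a)|].
      apply (wsum_scal _ (-1)), (wsum_fsum _ 0 j
        (fun i x => / hf a ^ S (S j - i) * / x ^ S i) (fun i => / hf a ^ S (S j - i) * zbar i)).
      intros i Hi; apply wsum_scal, wsum_one_pow.
    + intros x Hx; cbv beta.
      assert (H0 := nzint_neq0 x Hx); assert (H1 := nzint_hf_neq a x Hx).
      assert (P := partial_fractions_simple (S j) (/ hf a) (/ x) (/ (hf a - x))).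
      (* The term of highest order in [/ x] is isolated: it cancels against the product with
         [/ hf a]. *)
      rewrite pf_part_0, fsum_last, Nat.sub_diag in P by lia.
      rewrite (fsum_ext 0 j _ (fun i => (/ hf a) ^ S (S j - i) * (/ x) ^ S i))
        by (intros i _; now rewrite !pow_inv).
      rewrite pow_1, <- !pow_inv, Rmult_minus_distr_r, (Rmult_comm (/ (hf a - x))), P.
      * simpl; ring.
      * field; repeat split; lra.
    + rewrite gam_0, pow_1, (fsum_ext 0 j (fun i => zbar i * / hf a ^ S (S j - i))
        (fun i => / hf a ^ S (S j - i) * zbar i)) by (intros; ring).
      f_equal; simpl; field; split; [apply pow_nonzero|]; lra.
  - unfold Wval; eapply is_series_eq.
    + apply is_series_Rplus; [apply (is_series_ttilde (S (S (S j)))); lia|].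
      apply (is_series_Rscal (-1)), (is_series_fsum_family 0 j
        (fun i a => zbar i * / hf a ^ S (S j - i)) (fun i => zbar i * ttilde (S (S j - i)))).
      intros i Hi; apply is_series_Rscal, is_series_ttilde; lia.
    + intros a; reflexivity.
    + rewrite (fsum_first 0 j) by lia.
      replace (S j + 2)%nat with (S (S (S j))) by lia.
      replace (S j - 1)%nat with j by lia.
      unfold zbar at 1; simpl ((-1) ^ 0); ring.
Qed.

Lemma is_series_single (b : nat) (c : R) : is_series (fun a => if Nat.eqb a b then c else 0) c.
Proof.
  induction b as [|b IH].
  - apply (is_series_decr_1 (fun a => if Nat.eqb a 0 then c else 0)).
    simpl; apply (is_series_eq (fun a => 0 * / INR (S a) ^ 2) _ (0 * zeta 2)).
    + apply is_series_Rscal, is_series_zeta; lia.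
    + intros; ring.
    + unfold plus, opp; simpl; ring.
  - apply (is_series_decr_1 (fun a => if Nat.eqb a (S b) then c else 0)).
    simpl; apply (is_series_eq _ _ _ _ IH); auto; unfold plus, opp; simpl; ring.
Qed.

Lemma INR_minus_neq a b : a <> b -> INR a - INR b <> 0.
Proof. intros H E; apply H, INR_eq; lra. Qed.

Lemma hf_minus a b : hf a - hf b = INR a - INR b.
Proof. unfold hf; ring. Qed.

(* The order of summation may be exchanged only after adding [1 / x], which symmetric
   summation does not see; exchanging it directly would give [- 2 * ttilde 2]. *)
Lemma hweight_sum_hf_simple b : wsum hweight (fun x => / (hf b - x) ^ 1) (- ttilde 2).
Proof.
  assert (Hb := hf_pos b).
  assert (W : wsum hweight (fun x => / x + / (hf b - x)) (- ttilde 2)).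
  { apply (kernel_sum _ (hf b * (1 + 2 * hf b))
      (fun a => / hf a ^ 2 + - (if Nat.eqb a b then gam 1 else 0))).
    - intros x Hx.
      assert (H0 := nzint_neq0 x Hx); assert (H1 := nzint_hf_neq b x Hx).
      assert (H2 := nzint_le_hf b x Hx).
      replace (/ x + / (hf b - x)) with (hf b * (/ x * / (hf b - x))) by (field; split; lra).
      rewrite Rabs_mult, (Rabs_pos_eq (hf b)), Rmult_assoc by lra.
      apply Rmult_le_compat_l; [lra|].
      rewrite Rabs_mult, !Rabs_inv, <- (pow2_abs x).
      apply Rabs_no_R0 in H0; apply Rabs_no_R0 in H1.
      assert (P0 := Rabs_pos x); assert (P1 := Rabs_pos (hf b - x)).
      apply Rle_trans with (/ Rabs x * ((1 + 2 * hf b) * / Rabs x)).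
      + apply Rmult_le_compat_l; [left; apply Rinv_0_lt_compat; lra|].
        replace (/ Rabs (hf b - x)) with (Rabs x * (/ Rabs x * / Rabs (hf b - x))) by (field; lra).
        replace ((1 + 2 * hf b) * / Rabs x)
          with ((1 + 2 * hf b) * Rabs (hf b - x) * (/ Rabs x * / Rabs (hf b - x))) by (field; lra).
        apply Rmult_le_compat_r; auto.
        apply Rmult_le_pos; left; apply Rinv_0_lt_compat; lra.
      + right; field; lra.
    (* For [a = b] the two simple poles merge into a double one, whence the extra [gam 1]. *)
    - intros a; assert (Ha := hf_pos a); destruct (Nat.eqb_spec a b) as [-> |Hab].
      + eapply wsum_eq; [apply (wsum_scal _ (-1)), (wsum_one_hf 1 b)| |].
        * intros x Hx; cbv beta.
          assert (H0 := nzint_neq0 x Hx); assert (H1 := nzint_hf_neq b x Hx).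
          field; repeat split; lra.
        * ring.
      + apply INR_minus_neq in Hab; rewrite <- hf_minus in Hab.
        eapply wsum_eq; [apply wsum_plus;
          [apply (wsum_scal _ (- (hf b / hf a / (hf a - hf b)))), (wsum_one_hf 0 b)
          |apply (wsum_scal _ (hf b / hf a / (hf a - hf b))), (wsum_one_hf 0 a)]| |].
        * intros x Hx; cbv beta.
          assert (H0 := nzint_neq0 x Hx); assert (H1 := nzint_hf_neq b x Hx).
          assert (H2 := nzint_hf_neq a x Hx).
          field; repeat split; lra.
        * rewrite gam_0; field; repeat split; lra.
    - eapply is_series_eq.
      + apply is_series_Rplus; [apply (is_series_ttilde 2); lia|].
        apply is_series_Ropp, (is_series_single b (gam 1)).
      + intros; reflexivity.
      + unfold gam; simpl; ring. }
  unfold wsum in *; apply (is_series_eq _ _ _ _ W); auto.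
  intros n; unfold pm; rewrite !pow_1, Rinv_opp; ring.
Qed.

(** The indices [a < b] give [Hnum (S k) b], those above [b] give the zeta value with its sign, and
    [a = b] gives 0 because [/ 0 = 0]. *)
Lemma is_series_offset_pow k b :
  (1 <= k)%nat ->
  is_series (fun a => (- / (INR a - INR b)) ^ S k) (Hnum (S k) b - (-1) ^ k * zeta (S k)).
Proof.
  intros Hk; induction b as [|b IH].
  - apply (is_series_decr_1 (fun a => (- / (INR a - INR 0)) ^ S k)).
    apply (is_series_eq (fun a => (-1) ^ S k * / INR (S a) ^ S k) _ ((-1) ^ S k * zeta (S k))).
    + apply is_series_Rscal, is_series_zeta; lia.
    + intros a; change (INR 0) with 0; rewrite Rminus_0_r.
      now rewrite <- Rinv_opp, pow_inv, inv_opp_pow.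
    + rewrite Hnum_0; change (INR 0) with 0; rewrite Rminus_diag, Rinv_0.
      unfold plus, opp; simpl; ring.
  - apply (is_series_decr_1 (fun a => (- / (INR a - INR (S b))) ^ S k)).
    apply (is_series_eq _ _ _ _ IH).
    + intros a; do 3 f_equal; rewrite !S_INR; ring.
    + rewrite Hnum_S; change (INR 0) with 0.
      rewrite <- Rinv_opp, Ropp_minus_distr, Rminus_0_r, pow_inv.
      unfold plus, opp; simpl; ring.
Qed.

Lemma ln_le_sub_1 x : 0 < x -> ln x <= x - 1.
Proof.
  intros Hx; rewrite <- (ln_exp (x - 1)); apply ln_le; auto.
  assert (H := exp_ineq1_le (x - 1)); lra.
Qed.

(** Both bounds add up [ln x <= x - 1], taken at ratios of consecutive integers. *)
Lemma Hnum_block_le N M : (1 <= N)%nat ->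
  ln (INR (S (N + M))) - ln (INR (S N)) <= Hnum 1 (N + M) - Hnum 1 N
    <= ln (INR (N + M)) - ln (INR N).
Proof.
  intros HN; induction M as [|M IH]; [rewrite Nat.add_0_r; lra|].
  rewrite Nat.add_succ_r, Hnum_S, pow_1.
  assert (P0 : 0 < INR (N + M)) by (apply lt_0_INR; lia).
  assert (P1 := INR_S_pos (N + M)); assert (P2 := INR_S_pos (S (N + M))).
  assert (L1 := ln_le_sub_1 (INR (S (S (N + M))) / INR (S (N + M)))
    (Rdiv_lt_0_compat _ _ P2 P1)).
  assert (L2 := ln_le_sub_1 (INR (N + M) / INR (S (N + M)))
    (Rdiv_lt_0_compat _ _ P0 P1)).
  rewrite ln_div in L1, L2 by lra.
  replace (INR (S (S (N + M))) / INR (S (N + M)) - 1) with (/ INR (S (N + M))) in L1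
    by (rewrite (S_INR (S (N + M))); field; lra).
  replace (INR (N + M) / INR (S (N + M)) - 1) with (- / INR (S (N + M))) in L2
    by (rewrite (S_INR (N + M)) in *; field; lra).
  lra.
Qed.

(** As [/ hf a] is twice the inverse of the odd number [2 a + 1], the partial sums are twice the
    harmonic blocks from [n + 1] to [2 n]. *)
Lemma is_series_log2 : is_series (fun a => / hf a - / INR (S a)) (2 * ln 2).
Proof.
  apply is_series_fsum.
  apply (is_lim_seq_ext (fun N => 2 * (Hnum 1 (S N + S N) - Hnum 1 (S N)))).
  - induction n as [|n IH].
    + rewrite fsum_single; simpl (1 + 1)%nat; rewrite !Hnum_S, Hnum_0; unfold hf; simpl; field.
    + rewrite fsum_last, <- IH by lia.
      replace (S (S n) + S (S n))%nat with (S (S (S n + S n))) by lia.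
      rewrite (Hnum_S 1 (S (S n + S n))), (Hnum_S 1 (S n + S n)), (Hnum_S 1 (S n)), !pow_1.
      unfold hf; rewrite !S_INR, plus_INR, !S_INR; assert (H := pos_INR n).
      field; lra.
  - apply (is_lim_seq_scal_l _ 2 (Finite _)).
    (* The lower bound of the block is the logarithm of [(2 N + 3) / (N + 2)], the upper one is
       exactly [ln 2]. *)
    apply (is_lim_seq_le_le (fun N => ln (2 - / (INR N + 2))) _ (fun _ => ln 2)).
    + intros N; assert (B := Hnum_block_le (S N) (S N) ltac:(lia)).
      assert (HN := pos_INR N); assert (H1 := INR_S_pos N).
      destruct B as [B1 B2]; split.
      * eapply Rle_trans; [|apply B1]; right.
        rewrite <- ln_div by apply INR_S_pos; f_equal.
        rewrite !S_INR, plus_INR, !S_INR; field; lra.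
      * eapply Rle_trans; [apply B2|]; right.
        rewrite <- ln_div by (rewrite ?plus_INR; lra); f_equal.
        rewrite plus_INR; field; lra.
    + apply (is_lim_seq_continuous ln (fun N => 2 - / (INR N + 2)) 2).
      * apply derivable_continuous_pt; exists (/ 2); apply derivable_pt_lim_ln; lra.
      * replace (Finite 2) with (Finite (2 - 0)) by (f_equal; ring).
        apply is_lim_seq_minus'; [apply is_lim_seq_const|apply is_lim_seq_inv_INR].
    + apply is_lim_seq_const.
Qed.

(** Induction on [b], each step being a telescoping series. The term [/ (INR a - INR b)] at [a = b]
    counts as 0. *)
Lemma is_series_offset_log b :
  is_series (fun a => / hf a - / (INR a - INR b)) (2 * ln 2 + Hnum 1 b).
Proof.
  induction b as [|b IH].
  - apply (is_series_eq (fun a => (/ hf a - / INR (S a)) + - (/ INR a - / INR (S a))) _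
      (2 * ln 2 + - (/ INR 0 - 0))).
    + apply is_series_Rplus; [apply is_series_log2|].
      apply is_series_Ropp, (is_series_telescoping (fun a => / INR a)).
      apply (is_lim_seq_ext (fun n => / (INR n + 0))); [|apply is_lim_seq_inv_INR].
      intros n; now rewrite Rplus_0_r.
    + intros a; change (INR 0) with 0; rewrite (Rminus_0_r (INR a)); ring.
    + change (INR 0) with 0; rewrite Hnum_0, Rinv_0; ring.
  - apply (is_series_eq (fun a => (/ hf a - / (INR a - INR b)) +
      - (/ (INR a - INR (S b)) - / (INR (S a) - INR (S b)))) _
      ((2 * ln 2 + Hnum 1 b) + - (/ (INR 0 - INR (S b)) - 0))).
    + apply is_series_Rplus; [apply IH|].
      apply is_series_Ropp, (is_series_telescoping (fun a => / (INR a - INR (S b)))).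
      apply is_lim_seq_inv_INR.
    + intros a; replace (INR (S a) - INR (S b)) with (INR a - INR b)
        by (rewrite !S_INR; ring); ring.
    + change (INR 0) with 0; rewrite Hnum_S, pow_1, Rminus_0_l, Rinv_opp; ring.
Qed.

(** The three pieces come from the first power of the offset [a - b], joined with [/ hf a] to
    converge, from its higher powers, and from the merged poles at [a = b]. *)
Definition Uval (j b : nat) : R :=
  gam j * (2 * ln 2 + Hnum 1 b)
  + fsum 1 j (fun k => gam (j - k) * (Hnum (S k) b - (-1) ^ k * zeta (S k)))
  - gam (S j).

(** For [a <> b] the poles [hf a] and [hf b] are separated with coefficients in powers of the
    offset; for [a = b] they form one pole of order [j + 2], which gives [gam (S j)]. *)
Lemma hweight_sum_hf j b :
  (1 <= j)%nat -> wsum hweight (fun x => / (hf b - x) ^ S j) (Uval j b).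
Proof.
  intros Hj; assert (Hb := hf_pos b).
  (* For [a = b] the powers of [/ (INR a - INR b)] vanish, because [/ 0 = 0]. *)
  apply (kernel_sum _ (2 ^ (S j - 2) * (1 + 2 * hf b) ^ 2)
    (fun a => (/ hf a * gam j + fsum 0 j (fun i => (- / (INR a - INR b)) ^ S (j - i) * gam i))
       + - (if Nat.eqb a b then gam (S j) else 0))).
  - intros x Hx.
    assert (H1 := nzint_hf_ge b x Hx); assert (H2 := nzint_le_hf b x Hx).
    assert (H3 := nzint_Rabs_ge1 x Hx).
    eapply Rle_trans; [apply Rabs_inv_pow_le; auto; lia|].
    rewrite Rmult_assoc; apply Rmult_le_compat_l; [apply pow_le; lra|].
    rewrite <- (pow2_abs x), <- (pow2_abs (hf b - x)).
    set (u := Rabs x) in *; set (v := Rabs (hf b - x)) in *; set (c := 1 + 2 * hf b) in *.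
    replace (/ v ^ 2) with (u ^ 2 * (/ u ^ 2 * / v ^ 2)) by (field; lra).
    replace (c ^ 2 * / u ^ 2) with ((c * v) ^ 2 * (/ u ^ 2 * / v ^ 2)) by (field; lra).
    apply Rmult_le_compat_r.
    + apply Rmult_le_pos; left; apply Rinv_0_lt_compat, pow_lt; lra.
    + apply pow_incr; lra.
  - intros a; assert (Ha := hf_pos a); destruct (Nat.eqb_spec a b) as [-> |Hab].
    + eapply wsum_eq; [apply wsum_plus; [apply (wsum_scal _ (/ hf b)), (wsum_one_hf j b)
        |apply (wsum_scal _ (-1)), (wsum_one_hf (S j) b)]| |].
      * intros x Hx; cbv beta; assert (H1 := nzint_hf_neq b x Hx).
        simpl; field; repeat split; try lra; apply pow_nonzero; lra.
      * rewrite Rminus_diag, Rinv_0, Ropp_0, fsum_zero.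
        2: intros; simpl; ring.
        simpl; field; split; try lra; apply pow_nonzero; lra.
    + apply INR_minus_neq in Hab; rewrite <- hf_minus in *.
      set (e := / (hf a - hf b)).
      eapply wsum_eq.
      * apply wsum_plus; [apply wsum_plus|].
        -- apply (wsum_scal _ (/ hf a)), (wsum_one_hf j b).
        -- apply (wsum_fsum _ 0 j (fun i x => (- e) ^ S (j - i) * / (hf b - x) ^ S i)
             (fun i => (- e) ^ S (j - i) * (gam i - / hf b ^ S i))).
           intros i Hi; apply wsum_scal, wsum_one_hf.
        -- apply (wsum_scal _ (- (- e) ^ S j)), (wsum_one_hf 0 a).
      * intros x Hx; cbv beta.
        assert (H1 := nzint_hf_neq b x Hx); assert (H2 := nzint_hf_neq a x Hx).
        assert (P := partial_fractions_simple j (- e) (/ (hf b - x)) (- / (hf a - x))).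
        rewrite pf_part_0 in P.
        rewrite (fsum_ext 0 j _ (fun i => (- e) ^ S (j - i) * (/ (hf b - x)) ^ S i))
          by (intros i _; now rewrite !pow_inv).
        rewrite pow_1, <- !pow_inv.
        replace ((/ hf a - / (hf a - x)) * (/ (hf b - x)) ^ S j) with
          (/ hf a * (/ (hf b - x)) ^ S j + (/ (hf b - x)) ^ S j * (- / (hf a - x))) by ring.
        rewrite P; [ring|].
        unfold e; field; repeat split; lra.
      (* This is the same decomposition at [x = 0]. The values there, missing from [wsum], add up to
         zero because the kernel term vanishes at 0. *)
      * assert (Q := partial_fractions_simple j (- e) (/ hf b) (- / hf a)).
        rewrite pf_part_0 in Q.
        rewrite (fsum_ext 0 j (fun i => (- e) ^ S (j - i) * (gam i - / hf b ^ S i))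
          (fun i => (- e) ^ S (j - i) * gam i + -1 * ((- e) ^ S (j - i) * (/ hf b) ^ S i)))
          by (intros i _; rewrite pow_inv; ring).
        rewrite fsum_plus, fsum_scal, gam_0, pow_1, <- pow_inv.
        set (s := fsum 0 j (fun i => (- e) ^ S (j - i) * (/ hf b) ^ S i)) in *.
        assert (Q' : s = (/ hf b) ^ S j * - / hf a - (- e) ^ S j * - / hf a).
        { rewrite Q; [ring|]; unfold e; field; repeat split; lra. }
        rewrite Q'; ring.
  - eapply is_series_eq.
    + apply is_series_Rplus; [|apply is_series_Ropp, (is_series_single b (gam (S j)))].
      apply is_series_Rplus; [apply (is_series_Rscal (gam j)), (is_series_offset_log b)|].
      apply (is_series_fsum_family 1 j
        (fun k a => gam (j - k) * (- / (INR a - INR b)) ^ S k)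
        (fun k => gam (j - k) * (Hnum (S k) b - (-1) ^ k * zeta (S k)))).
      intros k Hk; apply is_series_Rscal, is_series_offset_pow; lia.
    + intros a; cbv beta; f_equal.
      (* In the reversed sum the index is the exponent of the offset minus one; its term 0 joins
         [/ hf a * gam j] to form the logarithmic series. *)
      rewrite (fsum_rev j (fun i => (- / (INR a - INR b)) ^ S (j - i) * gam i)).
      rewrite (fsum_first 0 j) by lia; rewrite !Nat.sub_0_r, Nat.sub_diag, pow_1.
      rewrite (fsum_ext 1 j
        (fun k => (- / (INR a - INR b)) ^ S (j - (j - k)) * gam (j - k))
        (fun k => gam (j - k) * (- / (INR a - INR b)) ^ S k)); [ring|].
      intros k Hk; replace (j - (j - k))%nat with k by lia; ring.
    + unfold Uval; ring.
Qed.

(** * Weighted sums with poles at 0 and at a half-integer *)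

Lemma wsum_inv_simple w : wsum w (fun x => / x ^ 1) 0.
Proof.
  apply (is_series_eq (fun n => 0 * / INR (S n) ^ 2) _ (0 * zeta 2)).
  - apply is_series_Rscal, is_series_zeta; lia.
  - intros n; unfold pm; rewrite !pow_1, Rinv_opp; ring.
  - ring.
Qed.

Lemma binom_sym p q : binom (p + q) p = binom (p + q) q.
Proof.
  unfold binom; rewrite pascal_step1 by lia; f_equal; lia.
Qed.

Lemma hweight_sum_product p q b :
  wsum hweight (fun x => / x ^ S q * / (hf b - x) ^ S p)
    (fsum 0 q (fun j => binom (p + q - j) p * Wval j * / hf b ^ S (p + q - j))
     + fsum 0 p (fun j => binom (p + q - j) q * (/ hf b ^ S (p + q - j) * Uval j b))).
Proof.
  (* [Wval j] and [Uval j b] are the correct sums for [j >= 1]; at [j = 0] only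
     [Wval 0 + Uval 0 b] is, which suffices because both have the same coefficient. *)
  set (W' := fun j => match j with O => 0 | _ => Wval j end).
  set (U' := fun j => match j with O => - ttilde 2 | _ => Uval j b end).
  assert (HW : forall j, wsum hweight (fun x => / x ^ S j) (W' j)).
  { intros [|j]; [apply wsum_inv_simple|apply hweight_sum_pow; lia]. }
  assert (HU : forall j, wsum hweight (fun x => / (hf b - x) ^ S j) (U' j)).
  { intros [|j]; [apply hweight_sum_hf_simple|apply hweight_sum_hf; lia]. }
  eapply wsum_eq.
  - apply wsum_plus.
    + apply (wsum_fsum _ 0 q
        (fun j x => binom (p + q - j) p * / hf b ^ S (p + q - j) * / x ^ S j)
        (fun j => binom (p + q - j) p * / hf b ^ S (p + q - j) * W' j)).
      intros j _; apply wsum_scal, HW.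
    + apply (wsum_fsum _ 0 p
        (fun j x => binom (p + q - j) q * / hf b ^ S (p + q - j) * / (hf b - x) ^ S j)
        (fun j => binom (p + q - j) q * / hf b ^ S (p + q - j) * U' j)).
      intros j _; apply wsum_scal, HU.
  - intros x Hx; assert (Hb := hf_pos b).
    assert (H0 := nzint_neq0 x Hx); assert (H1 := nzint_hf_neq b x Hx).
    rewrite <- !pow_inv, (partial_fractions p q (/ hf b)) by (field; repeat split; lra).
    unfold pf_part; f_equal; apply fsum_ext; intros j _; rewrite <- !pow_inv; auto.
    now rewrite (Nat.add_comm p q).
  - rewrite !(fsum_first 0 q), !(fsum_first 0 p) by lia.
    rewrite (fsum_ext 1 q
      (fun j => binom (p + q - j) p * / hf b ^ S (p + q - j) * W' j)
      (fun j => binom (p + q - j) p * Wval j * / hf b ^ S (p + q - j)))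
      by (intros [|j] Hj; [lia|simpl W'; ring]).
    rewrite (fsum_ext 1 p
      (fun j => binom (p + q - j) q * / hf b ^ S (p + q - j) * U' j)
      (fun j => binom (p + q - j) q * (/ hf b ^ S (p + q - j) * Uval j b)))
      by (intros [|j] Hj; [lia|simpl U'; ring]).
    assert (W0 : Wval 0 = ttilde 2).
    { unfold Wval; rewrite fsum_nil by lia; simpl; ring. }
    assert (U0 : Uval 0 b = - (2 * ttilde 2)).
    { unfold Uval; rewrite fsum_nil, gam_0 by lia; unfold gam; simpl; ring. }
    rewrite W0, U0, Nat.sub_0_r, binom_sym; unfold W', U'; ring.
Qed.

(** The non-elementary series of the theorem, written with its indexing so that unfolding gives the
    stated form. *)
Definition HTser (k r : nat) : R :=
  Series1 (fun n => Hnum k (n - 1) / (INR n - 1 / 2) ^ r).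

Lemma is_series_HTser k r :
  (1 <= k)%nat -> (2 <= r)%nat -> is_series (fun n => / hf n ^ r * Hnum k n) (HTser k r).
Proof.
  intros Hk Hr; unfold HTser, Series1.
  apply (is_series_eq (fun n => Hnum k n * / hf n ^ r) _ (Series (fun n => Hnum k n * / hf n ^ r))).
  - now apply Series_correct, ex_series_Hnum_div_hf.
  - intros; ring.
  - apply Series_ext; intros n; rewrite INR_S_half; now replace (S n - 1)%nat with n by lia.
Qed.

Definition Usum (j r : nat) : R :=
  gam j * (HTser 1 r + 2 * ln 2 * ttilde r)
  + fsum 1 j (fun k => gam (j - k) * (HTser (S k) r - (-1) ^ k * zeta (S k) * ttilde r))
  - gam (S j) * ttilde r.

Lemma is_series_Usum j r :
  (2 <= r)%nat -> is_series (fun b => / hf b ^ r * Uval j b) (Usum j r).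
Proof.
  intros Hr; assert (T := is_series_ttilde r Hr).
  eapply is_series_eq.
  - apply is_series_Rplus; [apply is_series_Rplus|].
    + apply (is_series_Rscal (gam j)), is_series_Rplus;
        [apply (is_series_HTser 1 r); lia|apply (is_series_Rscal (2 * ln 2)), T].
    + apply (is_series_fsum_family 1 j
        (fun k b => gam (j - k) * (/ hf b ^ r * Hnum (S k) b
           + - ((-1) ^ k * zeta (S k)) * / hf b ^ r))
        (fun k => gam (j - k) * (HTser (S k) r + - ((-1) ^ k * zeta (S k)) * ttilde r))).
      intros k Hk; apply is_series_Rscal, is_series_Rplus;
        [apply is_series_HTser; lia|apply is_series_Rscal, T].
    + apply (is_series_Rscal (- gam (S j))), T.
  - intros b; unfold Uval.
    rewrite (fsum_ext 1 j _ (fun k => / hf b ^ r *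
      (gam (j - k) * (Hnum (S k) b - (-1) ^ k * zeta (S k))))) by (intros; ring).
    rewrite fsum_scal; ring.
  - unfold Usum.
    rewrite (fsum_ext 1 j (fun k => gam (j - k) * (HTser (S k) r + _))
      (fun k => gam (j - k) * (HTser (S k) r - (-1) ^ k * zeta (S k) * ttilde r)))
      by (intros; ring).
    ring.
Qed.

(** * Summation over the poles *)

Lemma fsum_inv_hf r N : fsum 0 N (fun b => / hf b ^ r) = hnum r (S N).
Proof.
  induction N as [|N IH].
  - rewrite fsum_single, hnum_S, hnum_0; ring.
  - rewrite fsum_last, IH, (hnum_S r (S N)) by lia; ring.
Qed.

Lemma hnum_lim r : (2 <= r)%nat -> is_lim_seq (fun N => hnum r (S N)) (ttilde r).
Proof.
  intros Hr; apply (is_lim_seq_ext _ _ _ (fsum_inv_hf r)).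
  now apply is_series_fsum, is_series_ttilde.
Qed.

Lemma hnum_le_ttilde r n : (2 <= r)%nat -> hnum r n <= ttilde r.
Proof.
  intros Hr; apply Rle_trans with (hnum r (S n)); [apply hnum_le; lia|].
  apply (is_lim_seq_incr_compare (fun N => hnum r (S N))); [now apply hnum_lim|].
  intros N; apply hnum_le; lia.
Qed.

(** The numbers [hf b - n] are all the positive half-integers together with the opposites of the
    first [n] of them. *)
Lemma is_series_hf_minus r n :
  (2 <= r)%nat ->
  is_series (fun b => / (hf b - INR n) ^ r) (ttilde r + (-1) ^ r * hnum r n).
Proof.
  intros Hr; induction n as [|n IH].
  - apply (is_series_eq _ _ _ _ (is_series_ttilde r Hr)).
    + intros b; change (INR 0) with 0; now rewrite Rminus_0_r.
    + rewrite hnum_0; ring.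
  - apply is_series_fsum.
    apply (is_lim_seq_ext _ _ _ (fun N => eq_sym (fsum_hf_minus (fun x => / x ^ r) N n))).
    apply is_series_fsum in IH.
    replace (ttilde r + (-1) ^ r * hnum r (S n))
      with ((ttilde r + (-1) ^ r * hnum r n) + / (- hf n) ^ r - 0)
      by (rewrite inv_opp_pow, hnum_S; ring).
    apply is_lim_seq_minus'; [apply is_lim_seq_plus'; [exact IH|apply is_lim_seq_const]|].
    destruct r as [|r]; [lia|].
    apply (is_lim_seq_ext (fun N => (/ (INR N + (/ 2 - INR n))) ^ S r)).
    { intros N; rewrite pow_inv; do 2 f_equal; unfold hf; ring. }
    apply is_lim_seq_pow_S, is_lim_seq_inv_INR.
Qed.

(** The numbers [hf b + n] are the positive half-integers without the first [n]. *)
Lemma is_series_hf_plus r n :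
  (2 <= r)%nat -> is_series (fun b => / (hf b + INR n) ^ r) (ttilde r - hnum r n).
Proof.
  intros Hr; induction n as [|n IH].
  - apply (is_series_eq _ _ _ _ (is_series_ttilde r Hr)).
    + intros b; change (INR 0) with 0; now rewrite Rplus_0_r.
    + rewrite hnum_0; ring.
  - apply is_series_fsum.
    apply (is_lim_seq_ext _ _ _ (fun N => eq_sym (fsum_hf_plus (fun x => / x ^ r) N n))).
    apply is_series_fsum in IH.
    replace (ttilde r - hnum r (S n)) with ((ttilde r - hnum r n) - / hf n ^ r + 0)
      by (rewrite hnum_S; ring).
    apply is_lim_seq_plus'; [apply is_lim_seq_minus'; [exact IH|apply is_lim_seq_const]|].
    destruct r as [|r]; [lia|].
    apply (is_lim_seq_ext (fun N => (/ (INR N + (1 + / 2 + INR n))) ^ S r)).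
    { intros N; rewrite pow_inv, hf_S; do 2 f_equal; unfold hf; ring. }
    apply is_lim_seq_pow_S, is_lim_seq_inv_INR.
Qed.

Lemma fsum_hf_minus_bound r N n :
  (2 <= r)%nat -> Rabs (fsum 0 N (fun b => / (hf b - INR n) ^ r)) <= 2 * ttilde r.
Proof.
  intros Hr; eapply Rle_trans; [apply fsum_Rabs|].
  apply Rle_trans with (hnum r (S N) + hnum r n).
  - induction n as [|n IH].
    + rewrite hnum_0, Rplus_0_r, <- fsum_inv_hf; right; apply fsum_ext; intros b _.
      change (INR 0) with 0; rewrite Rminus_0_r; apply Rabs_pos_eq; left; apply hf_pow_inv_pos.
    + rewrite (fsum_hf_minus (fun x => Rabs (/ x ^ r))), (hnum_S r n).
      assert (E : Rabs (/ (- hf n) ^ r) = / hf n ^ r).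
      { rewrite Rabs_inv, <- RPow_abs, Rabs_Ropp, (Rabs_pos_eq (hf n)); auto.
        left; apply hf_pos. }
      rewrite E; assert (A := Rabs_pos (/ (hf N - INR n) ^ r)); lra.
  - assert (A := hnum_le_ttilde r (S N) Hr); assert (B := hnum_le_ttilde r n Hr); lra.
Qed.

Lemma fsum_hf_plus_bound r N n :
  (2 <= r)%nat -> Rabs (fsum 0 N (fun b => / (hf b + INR n) ^ r)) <= ttilde r.
Proof.
  intros Hr; eapply Rle_trans; [apply fsum_Rabs|].
  eapply Rle_trans; [|apply (hnum_le_ttilde r (S N) Hr)].
  rewrite <- fsum_inv_hf; apply fsum_le; intros b.
  assert (Hb := hf_pos b); assert (Hn := pos_INR n).
  rewrite Rabs_pos_eq by (left; apply Rinv_0_lt_compat, pow_lt; lra).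
  apply Rinv_le_contravar; [apply pow_lt; lra|]; apply pow_incr; lra.
Qed.

Lemma is_series_Shat1 q :
  (2 <= q)%nat -> is_series (fun n => hnum 1 (S n) * / INR (S n) ^ q) (Shat1 q).
Proof. intros Hq; now apply Series_correct, ex_series_hnum_div_pow. Qed.

Lemma is_series_Shat1p p q :
  (2 <= p)%nat -> (2 <= q)%nat ->
  is_series (fun n => hnum 1 (S n) * hnum p (S n) * / INR (S n) ^ q) (Shat1p p q).
Proof.
  intros Hp Hq; apply Series_correct.
  apply (ex_series_Rle _ (fun n => ttilde p * (hnum 1 (S n) * / INR (S n) ^ q))).
  2: now apply ex_series_Rscal, ex_series_hnum_div_pow.
  intros n; assert (A := hnum_le_ttilde p (S n) Hp); assert (B := hnum_nonneg p (S n)).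
  assert (C : 0 <= hnum 1 (S n) * / INR (S n) ^ q).
  { apply Rmult_le_pos; [apply hnum_nonneg|left; apply INR_S_pow_inv_pos]. }
  replace (hnum 1 (S n) * hnum p (S n) * / INR (S n) ^ q)
    with (hnum p (S n) * (hnum 1 (S n) * / INR (S n) ^ q)) by ring.
  rewrite Rabs_pos_eq by now apply Rmult_le_pos.
  now apply Rmult_le_compat_r.
Qed.

(** The double sum of [h_|x| / (x ^ S q * (hf b - x) ^ S p)] in both orders: summing over [b] first
    gives the left-hand side, summing over [x] first, by [hweight_sum_product], the right-hand
    side. *)
Lemma residue_identity p q :
  (1 <= p)%nat -> (1 <= q)%nat ->
  (1 + (-1) ^ S q) * ttilde (S p) * Shat1 (S q)
    + ((-1) ^ S p - (-1) ^ S q) * Shat1p (S p) (S q)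
  = fsum 0 q (fun j => binom (p + q - j) p * Wval j * ttilde (S (p + q - j)))
    + fsum 0 p (fun j => binom (p + q - j) q * Usum j (S (p + q - j))).
Proof.
  intros Hp Hq.
  set (c := fun b =>
    fsum 0 q (fun j => binom (p + q - j) p * Wval j * / hf b ^ S (p + q - j))
     + fsum 0 p (fun j => binom (p + q - j) q * (/ hf b ^ S (p + q - j) * Uval j b))).
  assert (R1 : is_series c (fsum 0 q (fun j => binom (p + q - j) p * Wval j * ttilde (S (p + q - j)))
    + fsum 0 p (fun j => binom (p + q - j) q * Usum j (S (p + q - j))))).
  { apply is_series_Rplus.
    - apply (is_series_fsum_family 0 q
        (fun j b => binom (p + q - j) p * Wval j * / hf b ^ S (p + q - j))
        (fun j => binom (p + q - j) p * Wval j * ttilde (S (p + q - j)))).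
      intros j Hj; apply is_series_Rscal, is_series_ttilde; lia.
    - apply (is_series_fsum_family 0 p
        (fun j b => binom (p + q - j) q * (/ hf b ^ S (p + q - j) * Uval j b))
        (fun j => binom (p + q - j) q * Usum j (S (p + q - j)))).
      intros j Hj; apply is_series_Rscal, is_series_Usum; lia. }
  set (f := fun n b => hnum 1 (S n) * pm (fun x => / x ^ S q * / (hf b - x) ^ S p) n).
  set (r := fun n => (1 + (-1) ^ S q) * ttilde (S p) * (hnum 1 (S n) * / INR (S n) ^ S q)
    + ((-1) ^ S p - (-1) ^ S q) * (hnum 1 (S n) * hnum (S p) (S n) * / INR (S n) ^ S q)).
  assert (F : forall n b, f n b =
    hnum 1 (S n) * / INR (S n) ^ S q * / (hf b - INR (S n)) ^ S p
    + hnum 1 (S n) * ((-1) ^ S q * / INR (S n) ^ S q) * / (hf b + INR (S n)) ^ S p).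
  { intros n b; unfold f, pm; rewrite inv_opp_pow.
    replace (hf b - - INR (S n)) with (hf b + INR (S n)) by ring; ring. }
  assert (R2 : is_series c (Series r)).
  (* The factor 3 adds the bound [2 * ttilde (S p)] for positive [x] and [ttilde (S p)] for negative
     [x]. *)
  { apply (is_series_exchange f r c
      (fun n => 3 * ttilde (S p) * (hnum 1 (S n) * / INR (S n) ^ S q))).
    - apply ex_series_Rscal, ex_series_hnum_div_pow; lia.
    - intros n N; rewrite (fsum_ext 0 N _ _ (fun b _ => F n b)), fsum_plus, !fsum_scal.
      assert (A := fsum_hf_minus_bound (S p) N (S n) ltac:(lia)).
      assert (B := fsum_hf_plus_bound (S p) N (S n) ltac:(lia)).
      assert (C : 0 <= hnum 1 (S n) * / INR (S n) ^ S q).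
      { apply Rmult_le_pos; [apply hnum_nonneg|left; apply INR_S_pow_inv_pos]. }
      eapply Rle_trans; [apply Rabs_triang|].
      replace (hnum 1 (S n) * ((-1) ^ S q * / INR (S n) ^ S q))
        with ((-1) ^ S q * (hnum 1 (S n) * / INR (S n) ^ S q)) by ring.
      set (h := hnum 1 (S n) * / INR (S n) ^ S q) in *.
      rewrite !Rabs_mult, pow_1_abs, (Rabs_pos_eq h C), Rmult_1_l.
      apply (Rmult_le_compat_l h) in A; auto; apply (Rmult_le_compat_l h) in B; auto; lra.
    - intros n; eapply is_series_eq.
      + apply is_series_Rplus.
        * apply (is_series_Rscal (hnum 1 (S n) * / INR (S n) ^ S q)),
            (is_series_hf_minus (S p) (S n)); lia.
        * apply (is_series_Rscal (hnum 1 (S n) * ((-1) ^ S q * / INR (S n) ^ S q))),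
            (is_series_hf_plus (S p) (S n)); lia.
      + intros b; symmetry; apply F.
      + unfold r; ring.
    - intros b; apply hweight_sum_product. }
  assert (R3 : is_series r ((1 + (-1) ^ S q) * ttilde (S p) * Shat1 (S q)
    + ((-1) ^ S p - (-1) ^ S q) * Shat1p (S p) (S q))).
  { apply is_series_Rplus; apply is_series_Rscal;
      [apply is_series_Shat1|apply is_series_Shat1p]; lia. }
  apply is_series_unique in R1, R2, R3; congruence.
Qed.

(** * Reindexing the finite sums *)

Lemma fsum_pick i j m a :
  (i <= m <= j)%nat -> fsum i j (fun k => if Nat.eqb k m then a k else 0) = a m.
Proof.
  induction j as [|j IH]; intros H.
  - replace i with 0%nat by lia; replace m with 0%nat by lia; now rewrite fsum_single.
  - destruct (Nat.eq_dec m (S j)) as [-> |Hm].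
    + rewrite fsum_last, Nat.eqb_refl by lia; rewrite fsum_zero; [ring|].
      intros k Hk; destruct (Nat.eqb_spec k (S j)); [lia|auto].
    + rewrite fsum_last, IH by lia; destruct (Nat.eqb_spec (S j) m); [lia|ring].
Qed.

Lemma fsum_trunc i m n a :
  (m <= n)%nat -> (forall k, (m < k <= n)%nat -> a k = 0) -> fsum i n a = fsum i m a.
Proof.
  induction 1 as [|n H IH]; intros Ha; auto.
  destruct (Nat.le_gt_cases i (S n)) as [Hi|Hi].
  - rewrite fsum_last, IH, Ha by (try lia; intros; apply Ha; lia); ring.
  - now rewrite !fsum_nil by lia.
Qed.

(** Both sides run over the pairs [k >= 1], [l >= 0] with [k + l <= p]. *)
Lemma fsum_triangle (F : nat -> nat -> R) p :
  fsum 0 p (fun j => fsum 1 j (fun k => F k (j - k)%nat))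
  = fsum 1 p (fun k => fsum 0 (p - k) (F k)).
Proof.
  induction p as [|p IH].
  - now rewrite fsum_single, !fsum_nil by lia.
  - rewrite fsum_last, IH, !fsum_last by lia.
    rewrite Nat.sub_diag, fsum_single, <- Rplus_assoc, <- fsum_plus; f_equal.
    apply fsum_ext; intros k Hk.
    replace (S p - k)%nat with (S (p - k)) by lia; now rewrite fsum_last by lia.
Qed.

(** Only odd indices survive, with factor 2. The range is first extended to [2 * M], where [u]
    vanishes, so that [i = 2 * k - 1] matches [k] from 1 to [M]. *)
Lemma fsum_odd M (u : nat -> R) :
  (forall i, (M < i)%nat -> u i = 0) ->
  fsum 1 M (fun i => (1 - (-1) ^ i) * u i) = 2 * fsum 1 M (fun k => u (2 * k - 1)%nat).
Proof.
  intros Hu.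
  rewrite <- (fsum_trunc 1 M (2 * M) (fun i => (1 - (-1) ^ i) * u i)).
  2: lia. 2: intros k Hk; rewrite Hu by lia; ring.
  clear Hu; induction M as [|M IH].
  - rewrite !fsum_nil by lia; ring.
  - replace (2 * S M)%nat with (S (S (2 * M))) by lia.
    rewrite !fsum_last, IH by lia.
    replace (2 * S M - 1)%nat with (S (2 * M)) by lia.
    rewrite <- !tech_pow_Rmult, pow_1_even; ring.
Qed.

Lemma sum_pairs_eq N f :
  sum_pairs (S N) f = fsum 1 N (fun k => f k (S N - k)%nat).
Proof.
  unfold sum_pairs; rewrite fsum_last by lia.
  rewrite (fsum_zero 1 (S N) (fun k2 => if Nat.eqb (S N + k2) (S N) then f (S N) k2 else 0)).
  2: intros k Hk; destruct (Nat.eqb_spec (S N + k) (S N)); [lia|auto].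
  rewrite Rplus_0_r; apply fsum_ext; intros k1 Hk1.
  rewrite <- (fsum_pick 1 (S N) (S N - k1) (f k1)) by lia.
  apply fsum_ext; intros k2 Hk2.
  destruct (Nat.eqb_spec (k1 + k2) (S N)), (Nat.eqb_spec k2 (S N - k1)); auto; lia.
Qed.

Lemma sum_triples_eq N f :
  sum_triples (S N) f =
  fsum 1 (S N) (fun k1 => fsum 1 (N - 2 * k1) (fun k2 => f k1 k2 (S N - 2 * k1 - k2)%nat)).
Proof.
  unfold sum_triples; apply fsum_ext; intros k1 Hk1.
  rewrite (fsum_trunc 1 (N - 2 * k1) (S N)).
  2: lia.
  2: intros k2 Hk2; apply fsum_zero; intros k3 Hk3;
     destruct (Nat.eqb_spec (2 * k1 + k2 + k3) (S N)); [lia|auto].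
  apply fsum_ext; intros k2 Hk2.
  rewrite <- (fsum_pick 1 (S N) (S N - 2 * k1 - k2) (f k1 k2)) by lia.
  apply fsum_ext; intros k3 Hk3.
  destruct (Nat.eqb_spec (2 * k1 + k2 + k3) (S N)), (Nat.eqb_spec k3 (S N - 2 * k1 - k2));
    auto; lia.
Qed.

(** The leading terms of [Wval] give the pairs, with [k1 = j + 1]. In the others [zbar i] keeps the
    odd [i = 2 * k1 - 1], giving [2 * zeta (2 * k1)], and [k2 = j - i]. *)
Lemma Wval_sum p q :
  fsum 0 q (fun j => binom (p + q - j) p * Wval j * ttilde (S (p + q - j)))
  = sum_pairs (S (S q)) (fun k1 k2 =>
      binom (k2 + S p - 2) p * ttilde (k1 + 1) * ttilde (k2 + S p - 1))
    - 2 * sum_triples (S (S q)) (fun k1 k2 k3 =>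
      binom (k3 + S p - 2) p * zeta (2 * k1) * ttilde (k2 + 1) * ttilde (k3 + S p - 1)).
Proof.
  set (c := fun j => binom (p + q - j) p * ttilde (S (p + q - j))).
  (* The [match] puts 0 at [i = j], outside the range in [Wval], so that the sum fills a whole
     triangle. *)
  rewrite (fsum_ext 0 q _ (fun j => c j * ttilde (j + 2)
    + - fsum 1 j (fun i => zbar i * match (j - i)%nat with O => 0
        | S l => c (i + S l)%nat * ttilde (S (S l)) end))).
  2:{ intros j Hj; unfold Wval.
      rewrite (fsum_trunc 1 (j - 1) j) by
        (try lia; intros k Hk; replace (j - k)%nat with 0%nat by lia; ring).
      rewrite (fsum_ext 1 (j - 1) (fun i => zbar i * match _ with O => 0 | S _ => _ end)
        (fun i => c j * (zbar i * ttilde (S (j - i))))), fsum_scal; [unfold c; ring|].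
      intros i Hi; replace (j - i)%nat with (S (j - i - 1)) by lia.
      replace (i + S (j - i - 1))%nat with j by lia; ring. }
  rewrite fsum_plus, fsum_opp.
  rewrite (fsum_triangle (fun i l => zbar i * match l with O => 0
        | S l => c (i + S l)%nat * ttilde (S (S l)) end)).
  unfold Rminus; f_equal.
  - rewrite sum_pairs_eq, fsum_S; apply fsum_ext; intros j Hj; unfold c.
    replace (S (S q) - S j + S p - 2)%nat with (p + q - j)%nat by lia.
    replace (S (S q) - S j + S p - 1)%nat with (S (p + q - j)) by lia.
    replace (S j + 1)%nat with (j + 2)%nat by lia; ring.
  - f_equal; rewrite sum_triples_eq.
    set (u := fun i => zeta (i + 1) *
      fsum 1 (q - i) (fun l => c (i + l)%nat * ttilde (l + 1))).
    assert (Hu : forall i, (q <= i)%nat -> u i = 0).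
    { intros i Hi; unfold u; rewrite fsum_nil by lia; ring. }
    rewrite (fsum_ext 1 q _ (fun i => (1 - (-1) ^ i) * u i)).
    2:{ intros i Hi; rewrite fsum_scal, fsum_first by lia; unfold u, zbar.
        rewrite Rplus_0_l, Rmult_assoc; do 2 f_equal; apply fsum_ext.
        intros [|l] Hl; [lia|]; now rewrite Nat.add_1_r. }
    rewrite fsum_odd by (intros; apply Hu; lia); f_equal.
    rewrite (fsum_trunc 1 q (S (S q))).
    2: lia. 2: intros k Hk; apply fsum_nil; lia.
    apply fsum_ext; intros k Hk; unfold u.
    rewrite <- fsum_scal.
    replace (q - (2 * k - 1))%nat with (S q - 2 * k)%nat by lia.
    apply fsum_ext; intros l Hl; unfold c.
    replace (S (S q) - 2 * k - l + S p - 2)%nat with (p + q - (2 * k - 1 + l))%nat by lia.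
    replace (S (S q) - 2 * k - l + S p - 1)%nat with (S (p + q - (2 * k - 1 + l)))%nat by lia.
    replace (2 * k - 1 + 1)%nat with (2 * k)%nat by lia; ring.
Qed.

(** The index [l] is [j + 1] in the first sum, [j] in the second and [j - k] in the third; the signs
    come from [gam], which carries [1 - (-1) ^ l] instead of [(-1) ^ l - 1]. *)
Lemma Usum_sum p q :
  fsum 0 p (fun j => binom (p + q - j) q * Usum j (S (p + q - j)))
  = fsum 0 (S p) (fun l => ((-1) ^ l - 1) * binom (S p + S q - l - 1) q
        * ttilde (l + 1) * ttilde (S p + S q - l))
    - fsum 0 p (fun l => ((-1) ^ l - 1) * binom (S p + S q - l - 2) q * ttilde (l + 1)
        * (HTser 1 (S p + S q - l - 1) + 2 * ln 2 * ttilde (S p + S q - l - 1)))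
    - fsum 1 p (fun k => fsum 0 (S p - k - 1) (fun l =>
      ((-1) ^ l - 1) * binom (S p + S q - k - l - 2) q * ttilde (l + 1)
        * (HTser (k + 1) (S p + S q - k - l - 1)
           - (-1) ^ k * zeta (k + 1) * ttilde (S p + S q - k - l - 1)))).
Proof.
  set (G := fun k l => ((-1) ^ l - 1) * binom (S p + S q - k - l - 2) q * ttilde (l + 1)
        * (HTser (k + 1) (S p + S q - k - l - 1)
           - (-1) ^ k * zeta (k + 1) * ttilde (S p + S q - k - l - 1))).
  rewrite (fsum_ext 1 p _ (fun k => fsum 0 (p - k) (G k))).
  2: intros k Hk; now replace (S p - k - 1)%nat with (p - k)%nat by lia.
  (* The term [l = 0] of the first sum is zero, and the rest shifts to [j = l - 1]. *)
  rewrite <- fsum_triangle, (fsum_first 0 (S p)), fsum_S by lia.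
  simpl ((-1) ^ 0); rewrite Rminus_diag, !Rmult_0_l, Rplus_0_l.
  match goal with |- _ = ?A - ?B - ?C => replace (A - B - C) with (A + - B + - C) by ring end.
  rewrite <- !fsum_opp, <- !fsum_plus.
  apply fsum_ext; intros j Hj; unfold Usum.
  rewrite (fsum_ext 1 j (fun k => G k (j - k)%nat) (fun k => - binom (p + q - j) q *
    (gam (j - k) * (HTser (S k) (S (p + q - j)) - (-1) ^ k * zeta (S k) * ttilde (S (p + q - j)))))).
  - rewrite fsum_scal; unfold gam.
    replace (S p + S q - S j - 1)%nat with (p + q - j)%nat by lia.
    replace (S p + S q - j - 2)%nat with (p + q - j)%nat by lia.
    replace (S p + S q - j - 1)%nat with (S (p + q - j)) by lia.
    replace (S p + S q - S j)%nat with (S (p + q - j)) by lia.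
    ring.
  - intros k Hk; unfold G, gam.
    replace (S p + S q - k - (j - k) - 2)%nat with (p + q - j)%nat by lia.
    replace (S p + S q - k - (j - k) - 1)%nat with (S (p + q - j)) by lia.
    rewrite (Nat.add_1_r k); ring.
Qed.

Theorem theorem4p4 (p q : nat) (hp : (1 < p)%nat) (hq : (1 < q)%nat) :
  (1 - (-1) ^ (p + q)) * Shat1p p q =
    (-1) ^ (p - 1) * (1 + (-1) ^ q) * ttilde p * Shat1 q
  + (-1) ^ p * fsum 0 p (fun l =>
      ((-1) ^ l - 1) * binom (p + q - l - 1) (q - 1)
        * ttilde (l + 1) * ttilde (p + q - l))
  + (-1) ^ (p - 1) * fsum 0 (p - 1) (fun l =>
      ((-1) ^ l - 1) * binom (p + q - l - 2) (q - 1) * ttilde (l + 1)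
        * (Series1 (fun n => Hnum 1 (n - 1) / (INR n - 1 / 2) ^ (p + q - l - 1))
           + 2 * ln 2 * ttilde (p + q - l - 1)))
  + (-1) ^ (p - 1) * fsum 1 (p - 1) (fun k => fsum 0 (p - k - 1) (fun l =>
      ((-1) ^ l - 1) * binom (p + q - k - l - 2) (q - 1) * ttilde (l + 1)
        * (Series1 (fun n =>
             Hnum (k + 1) (n - 1) / (INR n - 1 / 2) ^ (p + q - k - l - 1))
           - (-1) ^ k * zeta (k + 1) * ttilde (p + q - k - l - 1))))
  + (-1) ^ p * sum_pairs (q + 1) (fun k1 k2 =>
      binom (k2 + p - 2) (p - 1) * ttilde (k1 + 1) * ttilde (k2 + p - 1))
  - 2 * (-1) ^ p * sum_triples (q + 1) (fun k1 k2 k3 =>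
      binom (k3 + p - 2) (p - 1)
        * zeta (2 * k1) * ttilde (k2 + 1) * ttilde (k3 + p - 1)).
Proof.
  destruct p as [|p]; [lia|]; destruct q as [|q]; [lia|].
  assert (H := residue_identity p q ltac:(lia) ltac:(lia)).
  rewrite Wval_sum, Usum_sum in H; unfold HTser in H.
  replace (S p - 1)%nat with p by lia; replace (S q - 1)%nat with q by lia.
  rewrite Nat.add_1_r.
  match type of H with
  | _ = (?P - 2 * ?T) + (?A - ?B - ?C) =>
    set (sp := P) in *; set (st := T) in *; set (sa := A) in *;
    set (sb := B) in *; set (sc := C) in *
  end.
  assert (S2 : (-1) ^ p * (-1) ^ p = 1).
  { rewrite <- Rpow_mult_distr; replace (-1 * -1) with 1 by ring; apply pow1. }
  (* The sign squares to 1, so multiplying by it turns [(-1) ^ S p - (-1) ^ S q] into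
     [1 - (-1) ^ (S p + S q)]. *)
  transitivity ((-1) ^ S p * (((-1) ^ S p - (-1) ^ S q) * Shat1p (S p) (S q))).
  - rewrite pow_add; simpl; replace (-1 * (-1) ^ p * ((-1 * (-1) ^ p - -1 * (-1) ^ q)
      * Shat1p (S p) (S q))) with (((-1) ^ p * (-1) ^ p - (-1) ^ p * (-1) ^ q) * Shat1p (S p) (S q))
      by ring; rewrite S2; ring.
  - match type of H with ?X + ?Y = _ => replace Y with ((sp - 2 * st + (sa - sb - sc)) - X)
      by (rewrite <- H; ring) end.
    simpl ((-1) ^ S p); ring.
Qed.
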